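(* Let $$c=1-19x+16x^2,\quad d=1-5x,\quad g=1-32x,\quad a=\tfrac52-8x,\quad b=\tfrac32,$$ $$y^{+}=\frac{2x^2}{c+d\sqrt g},\qquad y^{-}=\frac{2x^2}{c-d\sqrt g}.$$ Then $$\left(\frac{c^2-d^2g}{4x}\right)^{1/3}=\left(\frac{a^2-b^2g}{4}\right)^{1/2}=1+4x,$$ $$y^+=x^2+O(x^3)\quad\text{and}\quad y^-=x+O(x^2)\quad\text{as } x\to0,$$ and in a neighbourhood of $x=0$ $$F_6(x)=\frac{2}{(a+b\sqrt g)^{1/2}}F_3(y^+)=\frac{1}{(a-b\sqrt g)^{1/2}}F_3(y^-),$$ where $F_3$ and $F_6$ are the power series defined in the context.
   Context: Here $q=e^{2\pi i\tau}$ with $\operatorname{Im}\tau>0$ and $\eta_m=q^{m/24}\prod_{j\ge1}(1-q^{mj})$. Roots are taken with the branch that is positive at $x=0$, and fractional powers of $q$-series with leading coefficient $1$. Level 3: $X_3=\frac{w}{(1+27w)^2}$ with $w=\eta_3^{12}/\eta_1^{12}$, and $Z_3=\eta_1^2\eta_3^2/X_3^{1/3}$. Level 6: $X_6=\frac{w}{(1-w)^2}$ with $w=\frac{\eta_1^{12}\eta_6^{12}}{\eta_2^{12}\eta_3^{12}}$, and $Z_6=\eta_1\eta_2\eta_3\eta_6/X_6^{1/2}$. For $\ell\in\{3,6\}$, $X_\ell=q+O(q^2)$, $Z_\ell=1+O(q)$, the coefficients $T_\ell(n)$ are defined by $Z_\ell=\sum_{n\ge0}T_\ell(n)X_\ell^n$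 near $q=0$, and $F_\ell(x)=\sum_{n\ge0}T_\ell(n)x^n$. One has $F_3(x)=\sum_{n\ge0}\binom{3n}{n}\binom{2n}{n}^2x^n$. Equivalently for level 6: $T_6(0)=1$ and, for $n\ge0$, $(n+1)^3T_6(n+1)=\sum_{j=1}^2(n+1-\tfrac j2)\{h_j-(n+1)(n+1-j)g_j\}T_6(n+1-j)$ (with $T_6(-1)=0$), where $1+g_1x+g_2x^2=(1+4x)(1-32x)$ and $h_1x+h_2x^2=8x(1+12x)$. *)

(* Defs.v *)
From HB Require Import structures.
From mathcomp Require Import all_boot all_order all_algebra.
From mathcomp Require Import complex.
From mathcomp Require Import all_classical all_reals all_analysis.

Set Implicit Arguments.
Unset Strict Implicit.
Unset Printing Implicit Defensive.

Import Order.TTheory GRing.Theory Num.Theory.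
Import numFieldNormedType.Exports.

Local Open Scope classical_set_scope.
Local Open Scope ring_scope.
Local Open Scope complex_scope.

(* R[i], as a field with a norm, carries the usual topology of the complex
   plane; mathcomp only attaches it to the alias R[i]^o. *)
HB.instance Definition _ (R : realType) := NormedModule.copy R[i] R[i]^o.

Section Complex.
Variable R : realType.
Implicit Types (z tau : R[i]).

Definition cexp z : R[i] :=
  (expR (complex.Re z))%:C * (cos (complex.Im z) +i* sin (complex.Im z)).

Definition cabs z : R := complex.Re `|z|.

(* Principal argument, in ]-pi, pi]. *)
Definition carg z : R :=
  let t := acos (complex.Re z / cabs z) in
  if 0 <= complex.Im z then t else - t.

(* Principal k-th root: holomorphic off the half-line ]-oo, 0] and positive on
   ]0, +oo[, hence the branch that is positive at 0 of f^(1/k) for any f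
   continuous at 0 with f 0 > 0.  (sqrtC and k.-root use another branch, cut
   along ]0, +oo[.) *)
Definition croot (k : nat) z : R[i] :=
  (cabs z `^ k%:R^-1)%:C * cexp (0 +i* (carg z / k%:R)).

Definition csum (u : nat -> R[i]) : R[i] := limn (series u).

(* qpow r tau is q^r = e^(2 pi i r tau). *)
Definition qpow (r : R) tau : R[i] := cexp ((0 +i* (2 * pi * r)) * tau).

(* eta m tau is q^(m/24) prod_(j >= 1) (1 - q^(m j)). *)
Definition eta (m : nat) tau : R[i] :=
  qpow (m%:R / 24) tau
  * limn (fun n => \prod_(1 <= j < n.+1) (1 - qpow 1 tau ^+ (m * j))).

(* If f = q + O(q^2), the fractional power f^(1/k) = q^(1/k) (1 + O(q)) with
   leading coefficient 1, valid when q is small. *)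
Definition qroot (k : nat) (f : R[i] -> R[i]) tau : R[i] :=
  qpow k%:R^-1 tau * croot k (f tau / qpow 1 tau).

Definition X3 tau : R[i] :=
  let w := eta 3 tau ^+ 12 / eta 1 tau ^+ 12 in w / (1 + 27 * w) ^+ 2.

Definition Z3 tau : R[i] := eta 1 tau ^+ 2 * eta 3 tau ^+ 2 / qroot 3 X3 tau.

Definition X6 tau : R[i] :=
  let w := eta 1 tau ^+ 12 * eta 6 tau ^+ 12
           / (eta 2 tau ^+ 12 * eta 3 tau ^+ 12) in
  w / (1 - w) ^+ 2.

Definition Z6 tau : R[i] :=
  eta 1 tau * eta 2 tau * eta 3 tau * eta 6 tau / qroot 2 X6 tau.

(* Z = sum_n T n X^n near q = 0.  As |q| = e^(- 2 pi Im tau), the punctured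
   discs around q = 0 are the half-planes B < Im tau.  When X = q + O(q^2)
   this determines T. *)
Definition expansion (Z X : R[i] -> R[i]) (T : nat -> R[i]) : Prop :=
  exists B : R, forall tau : R[i], B < complex.Im tau ->
    series (fun n => T n * X tau ^+ n) @ \oo --> Z tau.

Definition Fterm (T : nat -> R[i]) (x : R[i]) : nat -> R[i] :=
  fun n => T n * x ^+ n.
Definition Fsum (T : nat -> R[i]) (x : R[i]) : R[i] := csum (Fterm T x).
End Complex.

(* Main.v *)
(* Write q = e^(2 i pi tau) and E_m = prod_j (1 - q^(m j)), and let
   s = q E_2 E_6^5 / (E_1^5 E_3), the inverse of a Hauptmodul of Gamma_0(6).
   Everything is rational in s once
     1 + 8 s = E_2^4 E_3^8 / (E_1^8 E_6^4),  1 + 9 s = E_2^9 E_3^3 / (E_1^9 E_6^3)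
   are known.  These follow from the Jacobi triple product: it expresses
   phi(-q) = E_1^2 / E_2, psi(q) = E_2^2 / E_1 and two further eta quotients as
   theta series, which gives the 3-dissections
     psi(x) = A(x^3) + x psi(x^9),  phi(-x) = phi(-x^9) - 2 x B(x^3),
   and multiplying each over x = p, w p, w^2 p (w a primitive cube root of unity)
   yields the two identities at q = p^3.
   With D = 1 + 16 s + 72 s^2 one then finds
     X6 = s (1 + 8 s) (1 + 9 s) / D^2,
     X3 = s (1 + 8 s)^2 (1 + 9 s) / (1 + 12 s)^6,
     X3 (2 tau) = s^2 (1 + 8 s) (1 + 9 s)^2 / (1 + 6 s)^6,
   and Z6 : Z3 : Z3 (2 tau) = D : (1 + 12 s)^2 : (1 + 6 s)^2.  Hence, if
   x = X6 (tau), then sqrt (1 - 32 x) = (1 - 72 s^2) / D, y- = X3 (tau) and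
   y+ = X3 (2 tau).  Every small x <> 0 is X6 (tau) for some tau high in the upper
   half-plane, so the identities hold pointwise; at x = 0 they amount to
   T6 0 = T3 0 = 1. *)
Require Import Defs.
From mathcomp Require Import all_boot all_order all_algebra.
From mathcomp Require Import complex.
From mathcomp Require Import all_classical all_reals all_analysis.
From mathcomp Require Import zify ring lra.

Import Order.TTheory GRing.Theory Num.Theory.
Import numFieldNormedType.Exports.

Set Implicit Arguments.
Unset Strict Implicit.
Unset Printing Implicit Defensive.

Local Open Scope classical_set_scope.
Local Open Scope ring_scope.

(** Neither holomorphy nor modularity is used: the proof consists of explicit inequalities on small
    discs and rational identities in [s]. Regularity at q = 0 is the Lipschitz property [lip0],
    stable under sums, products and inverses of functions nonzero at 0. It serves twice: it keeps
    the relevant quotients within 1/4 of 1, and it makes q |-> x / r2(q)^2 a contraction, which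
    replaces the inverse function theorem for X6. The coefficients are accessible only through
    [expansion], that is, at arguments of the form X(tau). Convergence of F_3 at y+ and y- is
    therefore not deduced from a radius of convergence: these points are values of X3, where
    [expansion] gives both convergence and sum. The delicate point is the choice of branches, since
    Z3 and Z6 contain principal roots. It is settled by writing X6 / q, X3 / q and X3(2 tau) / q^2
    as exact squares or cubes of explicit functions equal to 1 at q = 0; near 1 the principal root
    undoes the power. *)

(** * Modulus, limits and geometric Cauchy sequences in the complex plane *)

Section ComplexTopology.
Variable R : realType.
Implicit Types (x y z : R[i]) (u v : nat -> R[i]).

Lemma cabsE z : `|z| = (cabs z)%:C%C.
Proof. by rewrite /cabs normc_def. Qed.

Lemma cabsM x y : cabs (x * y) = cabs x * cabs y.
Proof. by apply: (@complexI R); rewrite rmorphM -!cabsE normrM. Qed.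

Lemma cabs0 : cabs (0 : R[i]) = 0.
Proof. by apply: (@complexI R); rewrite -cabsE normr0. Qed.

Lemma cabs1 : cabs (1 : R[i]) = 1.
Proof. by apply: (@complexI R); rewrite -cabsE normr1. Qed.

Lemma cabsN z : cabs (- z) = cabs z.
Proof. by apply: (@complexI R); rewrite -!cabsE normrN. Qed.

Lemma cabsB x y : cabs (x - y) = cabs (y - x).
Proof. by rewrite -cabsN opprB. Qed.

Lemma cabsX z n : cabs (z ^+ n) = cabs z ^+ n.
Proof. by apply: (@complexI R); rewrite rmorphXn -!cabsE normrX. Qed.

Lemma cabsV z : cabs z^-1 = (cabs z)^-1.
Proof. by apply: (@complexI R); rewrite fmorphV -!cabsE normfV. Qed.

Lemma cabs_ge0 z : 0 <= cabs z.
Proof. by rewrite -ler0c -cabsE. Qed.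

Lemma cabs_eq0 z : (cabs z == 0) = (z == 0).
Proof. by rewrite -(inj_eq (@complexI R)) -cabsE normr_eq0. Qed.

Lemma cabs_gt0 z : (0 < cabs z) = (z != 0).
Proof. by rewrite lt_def cabs_ge0 andbT cabs_eq0. Qed.

Lemma cabsD x y : cabs (x + y) <= cabs x + cabs y.
Proof. by rewrite -lecR rmorphD -!cabsE ler_normD. Qed.

Lemma cabsBD x y : cabs (x - y) <= cabs x + cabs y.
Proof. by rewrite -(cabsN y) cabsD. Qed.

Lemma cabs_dist x y z : cabs (x - z) <= cabs (x - y) + cabs (y - z).
Proof. by apply: le_trans (cabsD _ _); rewrite addrA subrK. Qed.

Lemma cabs_ge_sub x y : cabs x - cabs y <= cabs (x - y).
Proof. by rewrite lerBlDr; apply: le_trans (cabsD _ _); rewrite subrK. Qed.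

Lemma cabs_nat n : cabs (n%:R : R[i]) = n%:R.
Proof. by apply: (@complexI R); rewrite -cabsE rmorph_nat normr_nat. Qed.

Lemma cabs_sqr z : cabs z ^+ 2 = complex.Re z ^+ 2 + complex.Im z ^+ 2.
Proof.
by apply: (@complexI R); rewrite [RHS]add_Re2_Im2 [LHS]rmorphXn /= -cabsE.
Qed.

Lemma normr_Re_le z : `|complex.Re z| <= cabs z.
Proof.
rewrite -ler_sqr ?nnegrE ?cabs_ge0 // real_normK ?num_real // cabs_sqr.
by rewrite lerDl sqr_ge0.
Qed.

Lemma normr_Im_le z : `|complex.Im z| <= cabs z.
Proof.
rewrite -ler_sqr ?nnegrE ?cabs_ge0 // real_normK ?num_real // cabs_sqr.
by rewrite lerDr sqr_ge0.
Qed.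

Lemma cabs_le_ReIm z : cabs z <= `|complex.Re z| + `|complex.Im z|.
Proof.
rewrite -ler_sqr ?nnegrE ?cabs_ge0 ?addr_ge0 // cabs_sqr sqrrD.
by rewrite !real_normK ?num_real // addrAC lerDl mulrn_wge0 // mulr_ge0.
Qed.

Lemma cabs_sum_le I (s : seq I) (P : pred I) (F : I -> R[i]) :
  cabs (\sum_(i <- s | P i) F i) <= \sum_(i <- s | P i) cabs (F i).
Proof.
elim/big_ind2: _ => //; first by rewrite cabs0.
by move=> x1 x2 y1 y2 h1 h2; apply: le_trans (cabsD _ _) (lerD h1 h2).
Qed.

(** The norm of [R[i]] takes its values in [R[i]], so the radii of balls are complex numbers. A
    positive one is real, which allows all later estimates to be made in [R] with [cabs]. *)
Lemma near0P (P : R[i] -> Prop) :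
  (\forall x \near (0 : R[i]), P x) <->
  exists2 d : R, 0 < d & forall x, cabs x < d -> P x.
Proof.
split=> [/nbhs_ballP[e e0 he]|[d d0 hd]].
  have := e0; rewrite /= => e0'.
  have er : (complex.Re e)%:C%C = e by rewrite RRe_real // gtr0_real.
  exists (complex.Re e); first by rewrite -ltcR er.
  move=> x hx; apply: he; rewrite -ball_normE /= sub0r normrN -er cabsE.
  by rewrite ltcR.
apply/nbhs_ballP; exists d%:C%C; first by rewrite /= ltcR.
by move=> x; rewrite -ball_normE /= sub0r normrN cabsE ltcR => /hd.
Qed.

Lemma cvgn_cabsP u (l : R[i]) : u @ \oo --> l <->
  forall e : R, 0 < e -> \forall n \near \oo, cabs (u n - l) < e.
Proof.
split=> [/cvgrPdist_lt h e e0|h].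
  have e0' : (0 : R[i]) < e%:C%C by rewrite ltcR.
  by apply: filterS (h _ e0') => n; rewrite cabsE ltcR cabsB.
apply/cvgrPdist_lt => e e0.
have er : (complex.Re e)%:C%C = e by rewrite RRe_real // gtr0_real.
have e0' : 0 < complex.Re e by rewrite -ltcR er.
by apply: filterS (h _ e0') => n; rewrite -er cabsE ltcR cabsB.
Qed.

Lemma cvgn_ext u v (l : R[i]) :
  (forall n, u n = v n) -> u @ \oo --> l -> v @ \oo --> l.
Proof. by move=> /funext ->. Qed.

Lemma cvgn_unique u (l m : R[i]) : u @ \oo --> l -> u @ \oo --> m -> l = m.
Proof. by move=> h k; apply: cvg_unique h k. Qed.

Lemma cvgn_mul u v (l m : R[i]) :
  u @ \oo --> l -> v @ \oo --> m -> (fun n => u n * v n) @ \oo --> l * m.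
Proof. exact: cvgM. Qed.

Lemma cvgn_mull u (c l : R[i]) :
  u @ \oo --> l -> (fun n => c * u n) @ \oo --> c * l.
Proof. by move=> h; apply: cvgM h; exact: cvg_cst. Qed.

Lemma cvgn_add u v (l m : R[i]) :
  u @ \oo --> l -> v @ \oo --> m -> (fun n => u n + v n) @ \oo --> l + m.
Proof. exact: cvgD. Qed.

Lemma cvgn_sub u v (l m : R[i]) :
  u @ \oo --> l -> v @ \oo --> m -> (fun n => u n - v n) @ \oo --> l - m.
Proof. exact: cvgB. Qed.

Lemma cvgn_inv u (l : R[i]) :
  l != 0 -> u @ \oo --> l -> (fun n => (u n)^-1) @ \oo --> l^-1.
Proof. exact: cvgV. Qed.

Lemma half_expr_cvg0 (C : R) : (fun n => C * (1 / 2) ^+ n) @ \oo --> (0 : R).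
Proof.
rewrite -[0 in X in _ --> X](mulr0 C); apply: cvgM; first exact: cvg_cst.
by apply: cvg_expr; rewrite ger0_norm; lra.
Qed.

Lemma cvgn_cabs_geometric u (l : R[i]) (C : R) :
  (forall n, cabs (u n - l) <= C * (1 / 2) ^+ n) -> u @ \oo --> l.
Proof.
move=> h; apply/cvgn_cabsP => e e0.
have /cvgrPdist_lt/(_ e e0) := half_expr_cvg0 C.
apply: filterS => n; rewrite sub0r normrN => hn.
exact: le_lt_trans (le_trans (h n) (ler_norm _)) hn.
Qed.

(** With d_n = 2 C / 2^n one has d_n - d_(n+1) = C / 2^n, so v - d increases and v + d decreases.
    Both tend to the same limit, and the enclosure between them is the rate. *)
Lemma real_geometric_cauchy (v : nat -> R) (C : R) :
  (forall n, `|v n.+1 - v n| <= C * (1 / 2) ^+ n) ->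
  exists l : R, forall n, `|v n - l| <= 2 * C * (1 / 2) ^+ n.
Proof.
move=> h; pose d n := 2 * C * (1 / 2) ^+ n : R.
have dS n : d n.+1 = d n - C * (1 / 2) ^+ n by rewrite /d exprS; field.
have C0 : 0 <= C by have := le_trans (normr_ge0 _) (h 0); rewrite expr0 mulr1.
have d0 n : 0 <= d n by rewrite /d !mulr_ge0 // exprn_ge0.
have lo : nondecreasing_seq (fun n => v n - d n).
  apply/nondecreasing_seqP => n; rewrite dS; have := h n; rewrite ler_norml.
  by move=> /andP[]; lra.
have hi : nonincreasing_seq (fun n => v n + d n).
  apply/nonincreasing_seqP => n; rewrite dS; have := h n; rewrite ler_norml.
  by move=> /andP[]; lra.
have dl : d @ \oo --> (0 : R) by exact: half_expr_cvg0.
have cv : cvgn (fun n => v n - d n).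
  apply: nondecreasing_is_cvgn => //; exists (v 0 + d 0) => _ [n _ <-] /=.
  by have := hi 0 n (leq0n n); have := d0 n; lra.
exists (limn (fun n => v n - d n)) => n.
have up : (fun n => v n + d n) @ \oo --> limn (fun n => v n - d n).
  rewrite -[X in _ --> X]addr0 -[X in _ + X](addr0 0).
  rewrite (_ : (fun n => v n + d n) = (fun n => (v n - d n) + (d n + d n))).
    exact: cvgD cv (cvgD dl dl).
  by apply/funext => k; ring.
have := nondecreasing_cvgn_le lo cv n.
have /(_ n) := nonincreasing_cvgn_ge hi (cvgP _ up).
by rewrite (cvg_lim _ up) // => h1 h2; rewrite ler_norml -/(d n); lra.
Qed.

(* R[i] has no complete-space instance, hence the detour through Re and Im. *)
Lemma complex_geometric_cauchy u (C : R) :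
  (forall n, cabs (u n.+1 - u n) <= C * (1 / 2) ^+ n) ->
  exists l : R[i], forall n, cabs (u n - l) <= 4 * C * (1 / 2) ^+ n.
Proof.
move=> h.
have [|a ha] := @real_geometric_cauchy (fun n => complex.Re (u n)) C.
  move=> n; apply: le_trans (h n); rewrite /= -raddfB.
  exact: normr_Re_le.
have [|b hb] := @real_geometric_cauchy (fun n => complex.Im (u n)) C.
  move=> n; apply: le_trans (h n); rewrite /= -raddfB.
  exact: normr_Im_le.
exists (Complex a b) => n; apply: le_trans (cabs_le_ReIm _) _.
have -> : complex.Re (u n - Complex a b) = complex.Re (u n) - a by case: (u n).
have -> : complex.Im (u n - Complex a b) = complex.Im (u n) - b by case: (u n).
by have := ha n; have := hb n; lra.
Qed.

Lemma limn_cabs u (l : R[i]) (C : R) :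
  u @ \oo --> l -> (forall n, cabs (u n) <= C) -> cabs l <= C.
Proof.
move=> hu hC; rewrite leNgt; apply/negP => lt.
have e0 : 0 < cabs l - C by rewrite subr_gt0.
have /cvgn_cabsP/(_ _ e0)[N _ /(_ N (leqnn N))] := hu.
have := cabs_ge_sub l (u N); rewrite (cabsB l); have := hC N; lra.
Qed.

End ComplexTopology.

(** * Gaussian binomials and the finite form of the triple product *)

Section GaussBinomial.
Variables (K : comNzRingType) (Q : K).

(** The Gaussian binomial coefficient, defined by a Pascal rule so that it exists in any commutative
    ring without division by q-factorials. *)
Fixpoint gbin M k : K :=
  match M, k with
  | _, 0 => 1
  | 0, _.+1 => 0
  | M'.+1, k'.+1 => gbin M' k'.+1 + Q ^+ (M' - k') * gbin M' k'
  end.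

Definition qfact n : K := \prod_(1 <= j < n.+1) (1 - Q ^+ j).

Lemma qfact0 : qfact 0 = 1. Proof. by rewrite /qfact big_geq. Qed.

Lemma qfactS n : qfact n.+1 = qfact n * (1 - Q ^+ n.+1).
Proof. by rewrite /qfact big_nat_recr. Qed.

Lemma gbinS M k : gbin M.+1 k.+1 = gbin M k.+1 + Q ^+ (M - k) * gbin M k.
Proof. by []. Qed.

Lemma gbin0 M : gbin M 0 = 1. Proof. by case: M. Qed.

Lemma gbin_small M k : (M < k)%N -> gbin M k = 0.
Proof.
elim: M k => [|M ih] [|k] // h.
by rewrite gbinS !ih ?mulr0 ?addr0 //; lia.
Qed.

Lemma gbin_qfact M k : (k <= M)%N -> gbin M k * (qfact k * qfact (M - k)) = qfact M.
Proof.
elim: M k => [|M ih] [|k] // h.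
- by rewrite /= qfact0 !mul1r.
- by rewrite gbin0 subn0 qfact0 !mul1r.
rewrite gbinS subSS; have := ih k h; rewrite (qfactS M) (qfactS k) => <-.
have [lt|ge] := ltnP k M; last first.
  rewrite gbin_small // (_ : M = k); last by lia.
  by rewrite subnn expr0; ring.
have := ih k.+1 lt; rewrite -(ih k h) qfactS.
have -> : (M - k = (M - k.+1).+1)%N by lia.
have -> : (M.+1 = (M - k.+1).+1 + k.+1)%N by lia.
rewrite qfactS exprD; set A := gbin M k.+1; set B := gbin M k.
set u := qfact k; set v := qfact _; set s := Q ^+ k.+1; set t := Q ^+ _ => e.
have -> : (A + t * B) * (u * (1 - s) * (v * (1 - t))) =
  A * (u * (1 - s) * v) * (1 - t) + t * B * (u * (1 - s) * (v * (1 - t))) by ring.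
by rewrite e; ring.
Qed.

(** Pascal's rule in the form that the induction on the triple product consumes: this version
    absorbs a new factor 1 + a (ab)^N, and [gbin_sum2], from the other Pascal rule, a new factor 1 +
    b (ab)^M. *)
Lemma gbin_sum1 M (T : nat -> K) :
  \sum_(0 <= k < M.+2) gbin M.+1 k * T k =
  \sum_(0 <= k < M.+1) gbin M k * (T k + Q ^+ (M - k) * T k.+1).
Proof.
rewrite big_nat_recl // gbin0.
under eq_bigr do rewrite gbinS mulrDl.
rewrite big_split /= addrA.
have -> : 1 * T 0 + \sum_(0 <= k < M.+1) gbin M k.+1 * T k.+1 =
    \sum_(0 <= k < M.+1) gbin M k * T k.
  rewrite -(gbin0 M) -(big_nat_recl _ _ (fun k => gbin M k * T k)) //.
  by rewrite big_nat_recr //= gbin_small // mul0r addr0.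
by rewrite -big_split; apply: eq_bigr => k _ /=; ring.
Qed.

Hypothesis qfact_reg : forall n, GRing.lreg (qfact n).

(** The mirror image of the defining rule. It is read off from the factorial formula by cancelling
    [qfact k.+1] and [qfact (M - k)], whence the regularity hypothesis. *)
Lemma gbinS' M k : (k <= M)%N -> gbin M.+1 k.+1 = gbin M k + Q ^+ k.+1 * gbin M k.+1.
Proof.
move=> h; rewrite gbinS.
have [lt|ge] := ltnP k M; last first.
  by rewrite gbin_small // (_ : M = k) ?subnn ?expr0; [ring|lia].
apply: (qfact_reg (n := k.+1)); apply: (qfact_reg (n := (M - k)%N)).
have := gbin_qfact lt; rewrite -(gbin_qfact h) qfactS.
have -> : (M - k = (M - k.+1).+1)%N by lia.
rewrite qfactS; set A := gbin M k.+1; set B := gbin M k.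
set u := qfact k; set v := qfact _; set s := Q ^+ k.+1; set t := Q ^+ _ => e.
rewrite /=; have -> : v * (1 - t) * (u * (1 - s) * (A + t * B)) =
  A * (u * (1 - s) * v) * (1 - t) + t * B * (u * (1 - s) * (v * (1 - t))) by ring.
have -> : v * (1 - t) * (u * (1 - s) * (B + s * A)) =
  s * (A * (u * (1 - s) * v)) * (1 - t) + B * (u * (1 - s) * (v * (1 - t))) by ring.
by rewrite e; ring.
Qed.

Lemma gbin_sum2 M (T : nat -> K) :
  \sum_(0 <= k < M.+2) gbin M.+1 k * T k =
  \sum_(0 <= k < M.+1) gbin M k * (Q ^+ k * T k + T k.+1).
Proof.
rewrite big_nat_recl // gbin0.
rewrite (eq_big_nat _ _ (F2 := fun k => Q ^+ k.+1 * (gbin M k.+1 * T k.+1)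
   + gbin M k * T k.+1)); last first.
  by move=> k /andP[_ h]; rewrite gbinS' //; ring.
rewrite big_split /= addrA.
have -> : 1 * T 0 + \sum_(0 <= k < M.+1) Q ^+ k.+1 * (gbin M k.+1 * T k.+1) =
    \sum_(0 <= k < M.+1) Q ^+ k * (gbin M k * T k).
  have -> : 1 * T 0 = Q ^+ 0 * (gbin M 0 * T 0) by rewrite gbin0 expr0 !mul1r.
  rewrite -(big_nat_recl _ _ (fun k => Q ^+ k * (gbin M k * T k))) //.
  by rewrite big_nat_recr //= gbin_small // mul0r mulr0 addr0.
by rewrite -big_split; apply: eq_bigr => k _ /=; ring.
Qed.

End GaussBinomial.

Fixpoint tri n := if n is m.+1 then (tri m + n)%N else 0%N.

Section FiniteTripleProduct.
Variables (K : comNzRingType) (a b : K).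
Hypothesis qfact_reg : forall n, GRing.lreg (qfact (a * b) n).

(* Ramanujan's theta function f(a, b) is the bilateral series whose terms of index
   n and - n are theta_term a b n and theta_term b a n. *)
Definition theta_term (x y : K) n : K := x ^+ tri n * y ^+ tri n.-1.

(* The term of index k - M: one of the two truncated subtractions vanishes. *)
Let T M k := theta_term a b (k - M) * theta_term b a (M - k).

Lemma theta_termE (x y : K) n :
  theta_term x y n.+1 = x ^+ tri n.+1 * y ^+ tri n.
Proof. by []. Qed.

Lemma theta_termS (x y : K) n :
  theta_term x y n.+1 = x * (x * y) ^+ n * theta_term x y n.
Proof.
rewrite /theta_term; case: n => [|n] /=; first by rewrite !expr0; ring.
by rewrite !exprD !exprMn !exprS; ring.
Qed.

(** A new factor 1 + b (ab)^M moves the centre of the index from M to M + 1. Its summand 1 is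
    accounted for by T (M + 1) (k + 1) = T M k, and its summand b (ab)^M by this identity. *)
Let T_b M k : b * (a * b) ^+ M * T M k = (a * b) ^+ k * T M.+1 k.
Proof.
rewrite /T; have [h|h] := leqP k M.
  have -> : (k - M = 0)%N by lia. have -> : (k - M.+1 = 0)%N by lia.
  have -> : (M.+1 - k = (M - k).+1)%N by lia.
  rewrite (theta_termS b) (mulrC b a).
  have -> : (a * b) ^+ M = (a * b) ^+ k * (a * b) ^+ (M - k).
    by rewrite -exprD; congr (_ ^+ _); lia.
  by rewrite /theta_term /= !expr0; ring.
have -> : (M - k = 0)%N by lia. have -> : (M.+1 - k = 0)%N by lia.
have -> : (k - M = (k - M.+1).+1)%N by lia.
rewrite (theta_termS a).
have -> : (a * b) ^+ k = (a * b) ^+ M * (a * b) ^+ (k - M.+1) * (a * b).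
  by rewrite -exprD -exprSr; congr (_ ^+ _); lia.
by rewrite /theta_term /= !expr0; ring.
Qed.

Let T_a N M k : (k <= N + M)%N ->
  a * (a * b) ^+ N * T M k = (a * b) ^+ (N + M - k) * T M k.+1.
Proof.
move=> hk; rewrite /T; have [h|h] := leqP M k.
  have -> : (M - k = 0)%N by lia. have -> : (M - k.+1 = 0)%N by lia.
  have -> : (k.+1 - M = (k - M).+1)%N by lia.
  rewrite (theta_termS a).
  have -> : (a * b) ^+ N = (a * b) ^+ (N + M - k) * (a * b) ^+ (k - M).
    by rewrite -exprD; congr (_ ^+ _); lia.
  by rewrite /theta_term /= !expr0; ring.
have -> : (k - M = 0)%N by lia. have -> : (k.+1 - M = 0)%N by lia.
have -> : (M - k = (M - k.+1).+1)%N by lia.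
rewrite (theta_termS b) (mulrC b a).
have -> : (a * b) ^+ (N + M - k) = (a * b) ^+ N * (a * b) ^+ (M - k.+1) * (a * b).
  by rewrite -exprD -exprSr; congr (_ ^+ _); lia.
by rewrite /theta_term /= !expr0; ring.
Qed.

Let triple_b M : \prod_(0 <= j < M) (1 + b * (a * b) ^+ j) =
  \sum_(0 <= k < M.+1) gbin (a * b) M k * T M k.
Proof.
elim: M => [|M ih].
  by rewrite big_geq // big_nat1 gbin0 /T /theta_term /= !expr0; ring.
rewrite big_nat_recr //= ih gbin_sum2 // mulr_suml.
apply: eq_bigr => k _; rewrite -T_b.
have -> : T M.+1 k.+1 = T M k by [].
by ring.
Qed.

(** Independent lengths N and M allow the factors to be added one at a time: those with b in
    [triple_b], then those with a here. Only N = M is used afterwards. *)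
Let triple_ab N M :
  \prod_(0 <= j < N) (1 + a * (a * b) ^+ j) *
  \prod_(0 <= j < M) (1 + b * (a * b) ^+ j) =
  \sum_(0 <= k < (N + M).+1) gbin (a * b) (N + M) k * T M k.
Proof.
elim: N => [|N ih]; first by rewrite [in LHS]big_geq // mul1r triple_b.
rewrite big_nat_recr //= mulrAC ih addSn gbin_sum1 // mulr_suml.
rewrite [LHS]big_nat [RHS]big_nat.
by apply: eq_bigr => k /andP[_ h]; rewrite -T_a //; ring.
Qed.

Lemma finite_triple_product N :
  \prod_(0 <= j < N) ((1 + a * (a * b) ^+ j) * (1 + b * (a * b) ^+ j)) =
  gbin (a * b) N.*2 N + \sum_(1 <= m < N.+1)
    (gbin (a * b) N.*2 (N + m) * theta_term a b m +
     gbin (a * b) N.*2 (N - m) * theta_term b a m).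
Proof.
rewrite big_split /= triple_ab addnn.
rewrite (@big_cat_nat _ _ _ N.+1) //=; last by rewrite -addnn; lia.
rewrite [X in X + _ = _]big_nat_recr //=.
have -> : T N N = 1 by rewrite /T subnn /theta_term /= !expr0; ring.
have -> : \sum_(0 <= k < N) gbin (a * b) N.*2 k * T N k =
    \sum_(1 <= m < N.+1) gbin (a * b) N.*2 (N - m) * theta_term b a m.
  rewrite big_nat_rev big_add1 /= big_nat [RHS]big_nat.
  apply: eq_bigr => k /andP[_ h]; rewrite add0n /T.
  have -> : (N - k.+1 - N = 0)%N by lia.
  have -> : (N - (N - k.+1) = k.+1)%N by lia.
  by rewrite {1}/theta_term !expr0 !mul1r.
have -> : \sum_(N.+1 <= k < N.*2.+1) gbin (a * b) N.*2 k * T N k =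
    \sum_(1 <= m < N.+1) gbin (a * b) N.*2 (N + m) * theta_term a b m.
  rewrite -[N.+1 in LHS]add1n big_addn.
  have -> : (N.*2.+1 - N = N.+1)%N by rewrite -addnn; lia.
  apply: eq_bigr => k _; rewrite addnC /T addKn.
  have -> : (N - (N + k) = 0)%N by lia.
  by rewrite {2}/theta_term !expr0 !mulr1.
by rewrite [in RHS]big_split /=; ring.
Qed.

End FiniteTripleProduct.

(** * The product of the 1 - q^j: convergence and Lipschitz bounds for |q| <= 1/4 *)

Section EulerProduct.
Variable R : realType.
Implicit Types (q : R[i]).

Definition euler q : R[i] := limn (qfact q).

Lemma cabsX_le (r : R) q n : cabs q <= r -> cabs (q ^+ n) <= r ^+ n.
Proof.
by move=> h; rewrite cabsX lerXn2r ?nnegrE ?cabs_ge0 // (le_trans _ h) ?cabs_ge0.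
Qed.

Lemma expr4_half n : (1 / 4 : R) ^+ n = (1 / 2) ^+ n * (1 / 2) ^+ n.
Proof. by rewrite -exprMn; congr (_ ^+ _); field. Qed.

Lemma half_itv n : 0 < (1 / 2 : R) ^+ n <= 1.
Proof. by rewrite exprn_gt0 ?exprn_ile1 //; lra. Qed.

Variable q0 : R[i].
Hypothesis q0_small : cabs q0 <= 1 / 4.

(** The weight 1 - 4^-n makes the induction close: a partial product is at most 5/3, so the next
    factor moves it by at most (5/12) 4^-n, while the bound grows by (1/2) 4^-n. Since 2/3 < 1, the
    product stays away from 0. *)
Lemma qfact_dist1 n : cabs (qfact q0 n - 1) <= 2 / 3 * (1 - (1 / 4) ^+ n).
Proof.
elim: n => [|n ih]; first by rewrite qfact0 subrr cabs0 expr0; lra.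
rewrite qfactS; have -> : qfact q0 n * (1 - q0 ^+ n.+1) - 1
   = (qfact q0 n - 1) - qfact q0 n * q0 ^+ n.+1 by ring.
apply: le_trans (cabsBD _ _) _; rewrite cabsM.
have := cabsX_le n.+1 q0_small.
have := cabs_ge_sub (qfact q0 n) 1; rewrite cabs1 !exprS.
have := cabs_ge0 (q0 * q0 ^+ n); have := cabs_ge0 (qfact q0 n).
have := half_itv n; rewrite expr4_half in ih *; move: ih.
set h := (1 / 2) ^+ n; nra.
Qed.

Lemma qfact_le n : cabs (qfact q0 n) <= 5 / 3.
Proof.
have := qfact_dist1 n; have := cabs_ge_sub (qfact q0 n) 1; rewrite cabs1.
by have := half_itv n; rewrite expr4_half; nra.
Qed.

Lemma qfact_ge n : 1 / 3 <= cabs (qfact q0 n).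
Proof.
have := qfact_dist1 n; have := cabs_ge_sub 1 (qfact q0 n); rewrite cabs1 cabsB.
by have := half_itv n; rewrite expr4_half; nra.
Qed.

Lemma qfact_neq0 n : qfact q0 n != 0.
Proof. by rewrite -cabs_gt0; have := qfact_ge n; lra. Qed.

Lemma qfact_cauchy n :
  cabs (qfact q0 n.+1 - qfact q0 n) <= 1 / 2 * (1 / 2) ^+ n.
Proof.
rewrite qfactS; have -> : qfact q0 n * (1 - q0 ^+ n.+1) - qfact q0 n
   = - (qfact q0 n * q0 ^+ n.+1) by ring.
rewrite cabsN cabsM.
apply: le_trans (ler_pM (cabs_ge0 _) (cabs_ge0 _) (qfact_le n)
  (cabsX_le n.+1 q0_small)) _.
by rewrite exprS expr4_half; have := half_itv n; nra.
Qed.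

Lemma qfact_euler_rate :
  qfact q0 @ \oo --> euler q0 /\
  forall n, cabs (qfact q0 n - euler q0) <= 2 * (1 / 2) ^+ n.
Proof.
have [l hl] := complex_geometric_cauchy qfact_cauchy.
have cl := cvgn_cabs_geometric hl.
have -> : euler q0 = l by apply: cvg_lim.
by split=> // n; have := hl n; lra.
Qed.

Lemma euler_cvg : qfact q0 @ \oo --> euler q0.
Proof. by case: qfact_euler_rate. Qed.

Lemma qfact_euler_dist n : cabs (qfact q0 n - euler q0) <= 2 * (1 / 2) ^+ n.
Proof. by case: qfact_euler_rate. Qed.

Lemma euler_dist1 : cabs (euler q0 - 1) <= 2 / 3.
Proof.
apply: (@limn_cabs _ (fun n => qfact q0 n - 1)).
  exact: (cvgB euler_cvg (cvg_cst (1 : R[i]))).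
by move=> n; have := qfact_dist1 n; have := half_itv n; rewrite expr4_half; nra.
Qed.

Lemma euler_neq0 : euler q0 != 0.
Proof.
rewrite -cabs_gt0; have := cabs_ge_sub 1 (euler q0).
by rewrite cabs1 cabsB; have := euler_dist1; lra.
Qed.

End EulerProduct.

Section EulerLipschitz.
Variable R : realType.
Implicit Types (q p : R[i]).

Lemma expr_lipschitz q p n : cabs q <= 1 / 4 -> cabs p <= 1 / 4 ->
  cabs (q ^+ n.+1 - p ^+ n.+1) <= (1 / 2) ^+ n * cabs (q - p).
Proof.
move=> hq hp; elim: n => [|n ih]; first by rewrite !expr1 expr0 mul1r.
have -> : q ^+ n.+2 - p ^+ n.+2
  = q * (q ^+ n.+1 - p ^+ n.+1) + p ^+ n.+1 * (q - p) by rewrite !exprS; ring.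
apply: le_trans (cabsD _ _) _; rewrite !cabsM.
have := cabsX_le n.+1 hp; rewrite (exprS (1 / 2)) (exprS (1 / 4)) expr4_half.
move: ih hq; have := half_itv R n.
have := cabs_ge0 (q - p); have := cabs_ge0 (q ^+ n.+1 - p ^+ n.+1).
have := cabs_ge0 q.
set h := (1 / 2) ^+ n; set d := cabs (q - p).
set a := cabs q; set b := cabs (_ - _); set c := cabs (p ^+ _).
move=> a0 b0 d0 /andP[h0 h1] ih qa pc.
have h2 : a * b <= 1 / 4 * (h * d) by apply: ler_pM.
have h3 : c * d <= 1 / 4 * (h * h) * d by rewrite ler_wpM2r.
have h4 : h * h * d <= h * d by rewrite ler_wpM2r // ler_piMr // ltW.
by lra.
Qed.

(** The constant 8 (1 - 2^-n) increases with n in order to pay for the factor |1 - q^(n+1)|, which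
    may exceed 1, and for the new difference of powers. *)
Lemma qfact_lipschitz q p n : cabs q <= 1 / 4 -> cabs p <= 1 / 4 ->
  cabs (qfact q n - qfact p n) <= 8 * (1 - (1 / 2) ^+ n) * cabs (q - p).
Proof.
move=> hq hp; elim: n => [|n ih].
  by rewrite !qfact0 subrr cabs0 expr0 subrr mulr0 mul0r.
have -> : qfact q n.+1 - qfact p n.+1 = (qfact q n - qfact p n)
  * (1 - q ^+ n.+1) - qfact p n * (q ^+ n.+1 - p ^+ n.+1).
  by rewrite !qfactS; ring.
apply: le_trans (cabsBD _ _) _; rewrite !cabsM.
have := expr_lipschitz n hq hp; have := qfact_le hp n.
have := cabsX_le n.+1 hq; have := cabsBD 1 (q ^+ n.+1); rewrite cabs1.
rewrite (exprS (1 / 2)) (exprS (1 / 4)) expr4_half; move: ih; have := half_itv R n.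
have := cabs_ge0 (q - p); have := cabs_ge0 (qfact q n - qfact p n).
have := cabs_ge0 (q ^+ n.+1 - p ^+ n.+1); have := cabs_ge0 (qfact p n).
have := cabs_ge0 (1 - q ^+ n.+1).
set h := (1 / 2) ^+ n; set d := cabs (q - p); set a := cabs (qfact q n - _).
set b := cabs (1 - _); set c := cabs (qfact p n).
set e := cabs (q ^+ n.+1 - _); set f := cabs (q ^+ n.+1).
move=> b0 c0 e0 a0 d0 /andP[h0 h1] ih bf fh c5 eh.
have h2 : a * b <= 8 * (1 - h) * d * (1 + h / 4).
  by apply: ler_pM => //; nra.
have h3 : c * e <= 5 / 3 * (h * d) by apply: ler_pM.
have := mulr_ge0 (ltW h0) d0.
have : 0 <= h * h * d by rewrite mulr_ge0 // mulr_ge0 // ltW.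
by lra.
Qed.

Lemma euler_lipschitz q p : cabs q <= 1 / 4 -> cabs p <= 1 / 4 ->
  cabs (euler q - euler p) <= 8 * cabs (q - p).
Proof.
move=> hq hp; apply: (@limn_cabs _ (fun n => qfact q n - qfact p n)).
  exact: cvgB (euler_cvg hq) (euler_cvg hp).
move=> n; apply: le_trans (qfact_lipschitz n hq hp) _.
by rewrite ler_wpM2r ?cabs_ge0 //; have := half_itv R n; lra.
Qed.

Lemma euler0 : euler (0 : R[i]) = 1.
Proof.
apply: cvg_lim => //; rewrite (_ : qfact 0 = fun=> 1 : R[i]); first exact: cvg_cst.
apply/funext; elim=> [|n ih]; first exact: qfact0.
by rewrite qfactS ih expr0n subr0 mulr1.
Qed.

End EulerLipschitz.

(** * Jacobi's triple product as the limit of the finite one *)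

Section TripleProduct.
Variable R : realType.
Implicit Types (a b q : R[i]).

Lemma qfact_lreg q n : cabs q <= 1 / 4 -> GRing.lreg (qfact q n).
Proof. by move=> h; apply/lregP; exact: qfact_neq0. Qed.

Lemma sum_half_le1 n : \sum_(1 <= m < n.+1) (1 / 2 : R) ^+ m <= 1.
Proof.
suff -> : \sum_(1 <= m < n.+1) (1 / 2 : R) ^+ m = 1 - (1 / 2) ^+ n.
  by have := half_itv R n; lra.
elim: n => [|n ih]; first by rewrite big_geq // expr0 subrr.
by rewrite big_nat_recr //= ih exprS; field.
Qed.

(** The three q-factorials in [gbin_qfact] have index at least n, so each is within 2 / 2^n of the
    Euler product. This bounds the numerator by 14 / 2^n, with 14 = 3 (5/3) 2 + 4, and the
    denominator has modulus at least 1/9: 126 = 9 * 14. *)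
Lemma gbin_dist q M k n : cabs q <= 1 / 4 -> (n <= k)%N -> (n + k <= M)%N ->
  cabs (euler q * gbin q M k - 1) <= 126 * (1 / 2) ^+ n.
Proof.
move=> hq nk nM; have kM : (k <= M)%N by lia.
have := gbin_qfact q kM; set i := qfact q k; set j := qfact q (M - k).
set m := qfact q M; set G := gbin _ _ _; set e := euler q => hG.
have mono l : (n <= l)%N -> cabs (qfact q l - e) <= 2 * (1 / 2) ^+ n.
  move=> hl; apply: le_trans (qfact_euler_dist hq l) _.
  by rewrite ler_wpM2l // ler_wiXn2l //; lra.
have hm : cabs (m - e) <= 2 * (1 / 2) ^+ n by apply: mono; lia.
have hi : cabs (i - e) <= 2 * (1 / 2) ^+ n by apply: mono.
have hj : cabs (j - e) <= 2 * (1 / 2) ^+ n by apply: mono; lia.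
have ii : 1 / 3 <= cabs i by exact: qfact_ge.
have jj : 1 / 3 <= cabs j by exact: qfact_ge.
have ee : cabs e <= 5 / 3.
  have := euler_dist1 hq; have := cabs_ge_sub e 1; rewrite cabs1 -/e; lra.
have key : (e * G - 1) * (i * j) =
   e * (m - e) - e * (i - e) - e * (j - e) - (i - e) * (j - e).
  have -> : (e * G - 1) * (i * j) = e * (G * (i * j)) - i * j by ring.
  by rewrite hG; ring.
have up : cabs ((e * G - 1) * (i * j)) <= 14 * (1 / 2) ^+ n.
  rewrite key; apply: le_trans (cabsBD _ _) _.
  have p1 := ler_pM (cabs_ge0 _) (cabs_ge0 _) ee hm.
  have p2 := ler_pM (cabs_ge0 _) (cabs_ge0 _) ee hi.
  have p3 := ler_pM (cabs_ge0 _) (cabs_ge0 _) ee hj.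
  have p4 := ler_pM (cabs_ge0 _) (cabs_ge0 _) hi hj.
  have p5 := cabsBD (e * (m - e) - e * (i - e)) (e * (j - e)).
  have p6 := cabsBD (e * (m - e)) (e * (i - e)).
  have p7 : 2 * (1 / 2) ^+ n * (2 * (1 / 2) ^+ n) <= 4 * (1 / 2 : R) ^+ n.
    by have := half_itv R n; nra.
  move: p1 p2 p3 p4 p5 p6; rewrite -!cabsM; lra.
have lo : 1 / 9 <= cabs (i * j).
  rewrite cabsM; apply: le_trans (ler_pM _ _ ii jj); lra.
move: up; rewrite cabsM => up.
have := ler_wpM2l (cabs_ge0 (e * G - 1)) lo; lra.
Qed.

(** The case |a| = 1 has to be allowed because psi is obtained with a = 1; the decay comes from ab
    alone. The bound by 1, proved simultaneously, is what the induction uses. *)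
Lemma theta_term_bound a b n : cabs a <= 1 -> cabs b <= 1 -> cabs (a * b) <= 1 / 4 ->
  cabs (theta_term a b n) <= 4 * (1 / 4) ^+ n.
Proof.
move=> ha hb hab; suff : cabs (theta_term a b n) <= 1 /\
  cabs (theta_term a b n) <= 4 * (1 / 4) ^+ n by case.
elim: n => [|n [ih _]].
  by rewrite /theta_term !expr0 mulr1 cabs1; split; lra.
have h : cabs (theta_term a b n.+1) <= (1 / 4) ^+ n.
  rewrite theta_termS cabsM (cabsM a) -[(1 / 4) ^+ n]mul1r -[X in _ <= X]mulr1.
  apply: ler_pM => //; rewrite ?mulr_ge0 ?cabs_ge0 //.
  by apply: ler_pM => //; rewrite ?cabs_ge0 //; exact: cabsX_le.
split; last by rewrite exprS; lra.
by apply: le_trans h _; apply: exprn_ile1; lra.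
Qed.

Definition theta_sum a b N : R[i] :=
  1 + \sum_(1 <= m < N.+1) (theta_term a b m + theta_term b a m).

Lemma theta_sumS a b N : theta_sum a b N.+1 =
  theta_sum a b N + (theta_term a b N.+1 + theta_term b a N.+1).
Proof. by rewrite /theta_sum big_nat_recr //= addrA. Qed.

(* Tannery's argument: the Gaussian binomials tend to 1 / euler (a b) at a rate
   that the Gaussian decay of the theta terms absorbs. *)
Lemma theta_sum_dist a b N :
  cabs a <= 1 -> cabs b <= 1 -> cabs (a * b) <= 1 / 4 ->
  cabs (euler (a * b) *
    \prod_(0 <= j < N) ((1 + a * (a * b) ^+ j) * (1 + b * (a * b) ^+ j)) -
    theta_sum a b N) <= 1134 * (1 / 2) ^+ N.
Proof.
move=> ha hb hab; rewrite finite_triple_product; last first.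
  by move=> n; exact: qfact_lreg.
rewrite /theta_sum mulrDr mulr_sumr opprD addrACA -sumrB.
apply: le_trans (cabsD _ _) _.
have h0 : cabs (euler (a * b) * gbin (a * b) N.*2 N - 1) <= 126 * (1 / 2) ^+ N.
  by apply: gbin_dist => //; rewrite addnn.
(* The central term costs 126. The terms of index i and -i cost 2 * 126 * 4 = 1008 times (1/2)^(N-i)
   (1/4)^i = (1/2)^N (1/2)^i, and the (1/2)^i sum to at most 1. *)
suff h1 : cabs (\sum_(1 <= i < N.+1) (euler (a * b) *
   (gbin (a * b) N.*2 (N + i) * theta_term a b i +
    gbin (a * b) N.*2 (N - i) * theta_term b a i) -
   (theta_term a b i + theta_term b a i))) <= 1008 * (1 / 2) ^+ N by lra.
apply: le_trans (cabs_sum_le _ _ _) _.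
have hs := sum_half_le1 N; have hN := half_itv R N.
apply: (@le_trans _ _
  (\sum_(1 <= i < N.+1) 1008 * (1 / 2) ^+ N * (1 / 2) ^+ i)); last first.
  rewrite -mulr_sumr -[X in _ <= X]mulr1; apply: ler_wpM2l hs.
  by case/andP: hN => h _; lra.
rewrite big_nat [X in _ <= X]big_nat; apply: ler_sum => i /andP[_ hi].
have -> : euler (a * b) * (gbin (a * b) N.*2 (N + i) * theta_term a b i +
      gbin (a * b) N.*2 (N - i) * theta_term b a i) -
     (theta_term a b i + theta_term b a i) =
   (euler (a * b) * gbin (a * b) N.*2 (N + i) - 1) * theta_term a b i +
   (euler (a * b) * gbin (a * b) N.*2 (N - i) - 1) * theta_term b a i by ring.
apply: le_trans (cabsD _ _) _; rewrite !(cabsM (_ - 1)).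
have g1 : cabs (euler (a * b) * gbin (a * b) N.*2 (N + i) - 1) <=
    126 * (1 / 2) ^+ (N - i).
  by apply: gbin_dist => //; rewrite -?addnn; lia.
have g2 : cabs (euler (a * b) * gbin (a * b) N.*2 (N - i) - 1) <=
    126 * (1 / 2) ^+ (N - i).
  by apply: gbin_dist => //; rewrite -?addnn; lia.
have t1 := theta_term_bound i ha hb hab.
have t2 : cabs (theta_term b a i) <= 4 * (1 / 4) ^+ i.
  by apply: theta_term_bound => //; rewrite mulrC.
have := ler_pM (cabs_ge0 _) (cabs_ge0 _) g1 t1.
have := ler_pM (cabs_ge0 _) (cabs_ge0 _) g2 t2.
have -> : (1 / 2 : R) ^+ N = (1 / 2) ^+ (N - i) * (1 / 2) ^+ i.
  by rewrite -exprD subnK.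
rewrite expr4_half; lra.
Qed.

(** The limit of the product is a parameter: each application supplies it as a quotient of Euler
    products. *)
Lemma jacobi_triple_product a b (p : R[i]) :
  cabs a <= 1 -> cabs b <= 1 -> cabs (a * b) <= 1 / 4 ->
  (fun N => \prod_(0 <= j < N) ((1 + a * (a * b) ^+ j) * (1 + b * (a * b) ^+ j)))
    @ \oo --> p ->
  theta_sum a b @ \oo --> euler (a * b) * p.
Proof.
move=> ha hb hab hp.
have h : (fun N => euler (a * b) *
    \prod_(0 <= j < N) ((1 + a * (a * b) ^+ j) * (1 + b * (a * b) ^+ j)) -
    theta_sum a b N) @ \oo --> (0 : R[i]).
  apply: cvgn_cabs_geometric => N; rewrite subr0; exact: theta_sum_dist.
have := cvgn_sub (cvgn_mull (c := euler (a * b)) hp) h; rewrite subr0.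
move=> cv; apply: (cvgn_ext _ cv) => N; exact: subKr.
Qed.

End TripleProduct.

(** * Four theta series as eta quotients, and the 3-dissections of psi and phi *)

Section ThetaProducts.
Variable R : realType.
Implicit Types (p q x : R[i]) (u v w : nat -> R[i]).

Lemma cvgn_subseq u (l : R[i]) (f : nat -> nat) : (forall n, n <= f n)%N ->
  u @ \oo --> l -> (fun n => u (f n)) @ \oo --> l.
Proof.
move=> hf /cvgn_cabsP h; apply/cvgn_cabsP => e e0.
have [N _ hN] := h e e0; exists N => // n /= nN.
by apply: hN; apply: leq_trans nN (hf n).
Qed.

(** [u n] may vanish for small n; as its limit does not, dividing is legitimate for large n, which
    is enough. *)
Lemma cvgn_quotient u v w (l m : R[i]) : (forall n, u n * v n = w n) ->
  l != 0 -> u @ \oo --> l -> w @ \oo --> m -> v @ \oo --> m / l.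
Proof.
move=> huv l0 hu hw; have hV := cvgn_inv l0 hu.
have := cvgn_mul hw hV; apply: cvg_trans; apply: near_eq_cvg.
have l0' : 0 < cabs l by rewrite cabs_gt0.
have /cvgn_cabsP/(_ _ l0') := hu; apply: filterS => n hn /=.
rewrite -huv mulrAC mulfV ?mul1r //; apply/eqP => un0.
by move: hn; rewrite un0 sub0r cabsN ltxx.
Qed.

Lemma cabsX_small q n : cabs q <= 1 / 4 -> cabs (q ^+ n.+1) <= 1 / 4.
Proof.
move=> h; apply: le_trans (cabsX_le n.+1 h) _; rewrite exprS.
by have := half_itv R n; rewrite expr4_half; nra.
Qed.

Lemma qfact_odd q N :
  qfact (q ^+ 2) N * \prod_(0 <= j < N) (1 - q ^+ j.*2.+1) = qfact q N.*2.
Proof.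
elim: N => [|N ih]; first by rewrite big_geq // !qfact0 mul1r.
rewrite big_nat_recr //= doubleS !qfactS -ih -exprM.
by rewrite (_ : (2 * N.+1 = N.*2.+2)%N); [ring|lia].
Qed.

Lemma cvg_prod_odd q : cabs q <= 1 / 4 ->
  (fun N => \prod_(0 <= j < N) (1 - q ^+ j.*2.+1)) @ \oo -->
  euler q / euler (q ^+ 2).
Proof.
move=> hq; have hq2 : cabs (q ^+ 2) <= 1 / 4 by exact: cabsX_small.
apply: (cvgn_quotient (qfact_odd q)); first exact: euler_neq0.
  exact: euler_cvg.
apply: (@cvgn_subseq _ _ double); last exact: euler_cvg.
by move=> n; rewrite -addnn leq_addr.
Qed.

Lemma qfact_plus q N :
  qfact q N * \prod_(0 <= j < N) (1 + q ^+ j.+1) = qfact (q ^+ 2) N.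
Proof.
elim: N => [|N ih]; first by rewrite big_geq // !qfact0 mul1r.
rewrite big_nat_recr //= !qfactS -ih -exprM mulnC exprM.
by ring.
Qed.

Lemma cvg_prod_plus q : cabs q <= 1 / 4 ->
  (fun N => \prod_(0 <= j < N) (1 + q ^+ j.+1)) @ \oo -->
  euler (q ^+ 2) / euler q.
Proof.
move=> hq; have hq2 : cabs (q ^+ 2) <= 1 / 4 by exact: cabsX_small.
apply: (cvgn_quotient (qfact_plus q)); first exact: euler_neq0.
  exact: euler_cvg.
exact: euler_cvg.
Qed.

Lemma theta_phi q : cabs q <= 1 / 4 ->
  theta_sum (- q) (- q) @ \oo --> euler q ^+ 2 / euler (q ^+ 2).
Proof.
move=> hq; have hq2 : cabs (q ^+ 2) <= 1 / 4 by exact: cabsX_small.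
have e2 : euler (q ^+ 2) != 0 by exact: euler_neq0.
have ee : - q * - q = q ^+ 2 by ring.
have -> : euler q ^+ 2 / euler (q ^+ 2) = euler (- q * - q) *
   (euler q / euler (q ^+ 2) * (euler q / euler (q ^+ 2))).
  by rewrite ee; move: (euler q) (euler _) e2 => u v v0; field.
apply: jacobi_triple_product; rewrite ?ee ?cabsN //; [lra|lra|].
have := cvgn_mul (cvg_prod_odd hq) (cvg_prod_odd hq).
move=> cv; apply: (cvgn_ext _ cv) => N /=.
rewrite -big_split /=; apply: eq_bigr => j _.
by rewrite -exprM -muln2 mulnC exprS; ring.
Qed.

(** This is f(1, q) = 2 psi(q). The 2 is the factor 1 + q^0, split off by shifting the index of the
    product. *)
Lemma theta_psi q : cabs q <= 1 / 4 ->
  theta_sum 1 q @ \oo --> 2 * (euler (q ^+ 2) ^+ 2 / euler q).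
Proof.
move=> hq; have e1 : euler q != 0 by exact: euler_neq0.
have -> : 2 * (euler (q ^+ 2) ^+ 2 / euler q) = euler (1 * q) *
   (2 * (euler (q ^+ 2) / euler q) * (euler (q ^+ 2) / euler q)).
  by rewrite mul1r; move: (euler q) (euler _) e1 => u v u0; field.
apply: jacobi_triple_product; rewrite ?mul1r ?cabs1 //; [lra|lra|].
have hp := cvg_prod_plus hq.
have h1 : (fun N => \prod_(0 <= j < N) (1 + q ^+ j)) @ \oo -->
    2 * (euler (q ^+ 2) / euler q).
  rewrite -cvg_shiftS.
  have := cvgn_mull (c := 2) hp.
  move=> cv; apply: (cvgn_ext _ cv) => N /=.
  by rewrite big_nat_recl //= expr0.
have := cvgn_mul h1 hp.
move=> cv; apply: (cvgn_ext _ cv) => N /=.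
rewrite -big_split /=; apply: eq_bigr => j _.
by rewrite exprS; ring.
Qed.

(** The series A of the overview. Its product runs over the 1 + q^j with j not divisible by 3, hence
    is the product over all j divided by the one for q^3. *)
Lemma theta_psi3 q : cabs q <= 1 / 4 -> theta_sum q (q ^+ 2) @ \oo -->
  euler (q ^+ 2) * euler (q ^+ 3) ^+ 2 / (euler q * euler (q ^+ 6)).
Proof.
move=> hq; have hX n : cabs (q ^+ n.+1) <= 1 / 4 by exact: cabsX_small.
have e1 : euler q != 0 by exact: euler_neq0.
have eX n : euler (q ^+ n.+1) != 0 by exact: euler_neq0.
have ee : q * q ^+ 2 = q ^+ 3 by ring.
have -> : euler (q ^+ 2) * euler (q ^+ 3) ^+ 2 / (euler q * euler (q ^+ 6)) =
  euler (q * q ^+ 2) *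
   ((euler (q ^+ 2) / euler q) / (euler ((q ^+ 3) ^+ 2) / euler (q ^+ 3))).
  rewrite ee -exprM; move: (eX 2) (eX 5) e1.
  move: (euler q) (euler (q ^+ 2)) (euler (q ^+ 3)) (euler _) => u v w z.
  by move=> w0 z0 u0; field; rewrite u0 w0 z0.
apply: jacobi_triple_product; rewrite ?ee //; [lra|by have := hX 1; lra|].
apply: (@cvgn_quotient (fun N => \prod_(0 <= j < N) (1 + (q ^+ 3) ^+ j.+1)) _
  (fun N => \prod_(0 <= j < (3 * N)%N) (1 + q ^+ j.+1))).
- move=> N /=; elim: N => [|N ih]; first by rewrite !big_geq // mul1r.
  rewrite mulnS addnC addn3 !big_nat_recr //= -ih -!exprM.
  have -> : (3 * N.+1 = (3 * N).+3)%N by lia.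
  by rewrite !exprS; ring.
- rewrite -exprM; apply: mulf_neq0; rewrite ?invr_eq0;
    [exact: (eX 5)|exact: (eX 2)].
- exact: cvg_prod_plus.
- apply: cvgn_subseq (cvg_prod_plus hq) => n; lia.
Qed.

(** The series B of the overview. Its product runs over the 1 - q^j with j prime to 6: the odd j,
    without the odd multiples of 3. *)
Lemma theta_phi3 q : cabs q <= 1 / 4 -> theta_sum (- q) (- q ^+ 5) @ \oo -->
  euler q * euler (q ^+ 6) ^+ 2 / (euler (q ^+ 2) * euler (q ^+ 3)).
Proof.
move=> hq; have hX n : cabs (q ^+ n.+1) <= 1 / 4 by exact: cabsX_small.
have eX n : euler (q ^+ n.+1) != 0 by exact: euler_neq0.
have ee : - q * - q ^+ 5 = q ^+ 6 by ring.
have -> : euler q * euler (q ^+ 6) ^+ 2 / (euler (q ^+ 2) * euler (q ^+ 3)) =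
  euler (- q * - q ^+ 5) *
   ((euler q / euler (q ^+ 2)) / (euler (q ^+ 3) / euler ((q ^+ 3) ^+ 2))).
  rewrite ee -exprM; move: (eX 1) (eX 2) (eX 5).
  move: (euler q) (euler (q ^+ 2)) (euler (q ^+ 3)) (euler _) => u v w z.
  by move=> v0 w0 z0; field; rewrite v0 w0 z0.
apply: jacobi_triple_product; rewrite ?ee ?cabsN //; [lra|by have := hX 4; lra|].
apply: (@cvgn_quotient (fun N => \prod_(0 <= j < N) (1 - (q ^+ 3) ^+ j.*2.+1)) _
  (fun N => \prod_(0 <= j < (3 * N)%N) (1 - q ^+ j.*2.+1))).
- move=> N /=; elim: N => [|N ih]; first by rewrite !big_geq // mul1r.
  rewrite mulnS addnC addn3 !big_nat_recr //= -ih.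
  have -> : q ^+ (3 * N).*2.+1 = q * (q ^+ 6) ^+ N.
    by rewrite -exprM -exprS; congr (_ ^+ _); lia.
  have -> : q ^+ (3 * N).+1.*2.+1 = q ^+ 3 * (q ^+ 6) ^+ N.
    by rewrite -exprM -exprD; congr (_ ^+ _); lia.
  have -> : q ^+ (3 * N).+2.*2.+1 = q ^+ 5 * (q ^+ 6) ^+ N.
    by rewrite -exprM -exprD; congr (_ ^+ _); lia.
  have -> : (q ^+ 3) ^+ N.*2.+1 = q ^+ 3 * (q ^+ 6) ^+ N.
    by rewrite -!exprM -exprD; congr (_ ^+ _); lia.
  by ring.
- rewrite -exprM; apply: mulf_neq0; rewrite ?invr_eq0;
    [exact: (eX 2)|exact: (eX 5)].
- exact: cvg_prod_odd.
- apply: cvgn_subseq (cvg_prod_odd hq) => n; lia.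
Qed.

Lemma double_tri n : (2 * tri n = n * n.+1)%N.
Proof. by elim: n => // n ih; rewrite /= mulnDr ih; nia. Qed.

(** Expressing these exponents linearly in [tri n] and [tri n.+1] lets [ring] verify the dissections
    with the two numbers as variables. *)
Lemma tri3 n : [/\ tri (3 * n + 1) = (1 + 9 * tri n)%N,
  tri (3 * n + 2) = (3 * tri n.+1 + 6 * tri n)%N,
  tri (3 * n + 3) = (6 * tri n.+1 + 3 * tri n)%N &
  tri (3 * n + 4) = (1 + 9 * tri n.+1)%N].
Proof.
have h := double_tri n; have h1 := double_tri n.+1.
have := double_tri (3 * n + 1); have := double_tri (3 * n + 2).
have := double_tri (3 * n + 3); have := double_tri (3 * n + 4).
by move=> *; split; nia.
Qed.

Lemma theta_sum3S a b N t t' : t = tri N -> t' = tri N.+1 ->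
  theta_sum a b (3 * N.+1 + 1) = theta_sum a b (3 * N + 1) +
  (a ^+ (3 * t' + 6 * t) * b ^+ (1 + 9 * t) +
   b ^+ (3 * t' + 6 * t) * a ^+ (1 + 9 * t)) +
  (a ^+ (6 * t' + 3 * t) * b ^+ (3 * t' + 6 * t) +
   b ^+ (6 * t' + 3 * t) * a ^+ (3 * t' + 6 * t)) +
  (a ^+ (1 + 9 * t') * b ^+ (6 * t' + 3 * t) +
   b ^+ (1 + 9 * t') * a ^+ (6 * t' + 3 * t)) :> R[i].
Proof.
move=> -> ->; have [e1 e2 e3 e4] := tri3 N.
have -> : (3 * N.+1 + 1 = (3 * N + 1).+3)%N by lia.
rewrite !theta_sumS !theta_termE.
have -> : ((3 * N + 1).+1 = 3 * N + 2)%N by lia.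
have -> : ((3 * N + 2).+1 = 3 * N + 3)%N by lia.
have -> : ((3 * N + 3).+1 = 3 * N + 4)%N by lia.
by rewrite e1 e2 e3 e4.
Qed.

(** The index is sorted modulo 3. The range |n| <= 3N + 1 has 3 (2N + 1) elements and splits exactly
    into three copies of |n| <= N, so the dissection already holds for partial sums. Two of the
    three classes agree, by the symmetry n |-> 1 - n, whence the 2. *)
Lemma psi_dissection_sum x N : theta_sum 1 x (3 * N + 1) =
  2 * theta_sum (x ^+ 3) (x ^+ 6) N + x * theta_sum 1 (x ^+ 9) N.
Proof.
elim: N => [|N ih].
  rewrite muln0 add0n /theta_sum big_nat1 !big_geq // /theta_term /=.
  by rewrite !expr1n !expr0 !expr1; ring.
rewrite (theta_sum3S _ _ erefl erefl) ih !theta_sumS !theta_termE.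
rewrite !expr1n !mul1r !mulr1.
move: (tri N.+1) (tri N) => t' t.
by rewrite !exprD !(exprAC x 3) !(exprAC x 6) !(exprAC x 9); ring.
Qed.

Lemma phi_dissection_sum y N : theta_sum y y (3 * N + 1) =
  theta_sum (y ^+ 9) (y ^+ 9) N + 2 * y * theta_sum (y ^+ 3) (y ^+ 15) N :> R[i].
Proof.
elim: N => [|N ih].
  rewrite muln0 add0n /theta_sum big_nat1 !big_geq // /theta_term /=.
  by rewrite !expr0 !expr1; ring.
rewrite (theta_sum3S _ _ erefl erefl) ih !theta_sumS !theta_termE.
move: (tri N.+1) (tri N) => t' t.
by rewrite !exprD !(exprAC y 3) !(exprAC y 9) !(exprAC y 15); ring.
Qed.

Lemma psi_dissection x : cabs x <= 1 / 4 ->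
  euler (x ^+ 2) ^+ 2 / euler x =
  euler (x ^+ 6) * euler (x ^+ 9) ^+ 2 / (euler (x ^+ 3) * euler (x ^+ 18)) +
  x * (euler (x ^+ 18) ^+ 2 / euler (x ^+ 9)).
Proof.
move=> hx; have hX n : cabs (x ^+ n.+1) <= 1 / 4 by exact: cabsX_small.
have c3 := theta_psi3 (hX 2); have c9 := theta_psi (hX 8).
have := cvgn_add (cvgn_mull (c := 2) c3) (cvgn_mull (c := x) c9).
have c : (fun N => 2 * theta_sum (x ^+ 3) (x ^+ 6) N + x * theta_sum 1 (x ^+ 9) N)
    @ \oo --> 2 * (euler (x ^+ 2) ^+ 2 / euler x).
  apply: (cvgn_ext (psi_dissection_sum x)).
  apply: (cvgn_subseq _ (theta_psi hx)) => n; lia.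
rewrite -!exprM => c'; have e := cvgn_unique c c'.
apply: (@mulfI _ (2 : R[i])); first by rewrite pnatr_eq0.
by apply: etrans e _; rewrite [RHS]mulrDr (mulrCA x).
Qed.

Lemma phi_dissection x : cabs x <= 1 / 4 ->
  euler x ^+ 2 / euler (x ^+ 2) =
  euler (x ^+ 9) ^+ 2 / euler (x ^+ 18) - 2 * x *
  (euler (x ^+ 3) * euler (x ^+ 18) ^+ 2 / (euler (x ^+ 6) * euler (x ^+ 9))).
Proof.
move=> hx; have hX n : cabs (x ^+ n.+1) <= 1 / 4 by exact: cabsX_small.
have c3 := theta_phi3 (hX 2); have c9 := theta_phi (hX 8).
have := cvgn_add c9 (cvgn_mull (c := 2 * - x) c3).
have c : (fun N => theta_sum (- x ^+ 9) (- x ^+ 9) N +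
    2 * - x * theta_sum (- x ^+ 3) (- x ^+ 15) N) @ \oo -->
    euler x ^+ 2 / euler (x ^+ 2).
  have -> : - x ^+ 9 = (- x) ^+ 9 by ring.
  have -> : - x ^+ 3 = (- x) ^+ 3 by ring.
  have -> : - x ^+ 15 = (- x) ^+ 15 by ring.
  apply: (cvgn_ext (phi_dissection_sum (- x))).
  apply: (cvgn_subseq _ (theta_phi hx)) => n; lia.
rewrite -!exprM => c'; have e := cvgn_unique c c'.
by apply: etrans e _; rewrite mulrN mulNr.
Qed.

End ThetaProducts.

(** * Products over the cube roots of unity, and the two level 6 identities *)

Section CubicIdentities.
Variables (R : realType) (w : R[i]).
Hypothesis w_cubic : 1 + w + w ^+ 2 = 0.
Implicit Types (p q : R[i]).

Let w3E : w ^+ 3 = 1.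
Proof.
have -> : w ^+ 3 = (1 + w + w ^+ 2) * (w - 1) + 1 by ring.
by rewrite w_cubic mul0r add0r.
Qed.

Let cabs_w : cabs w = 1.
Proof.
by apply/eqP; rewrite -(@pexpr_eq1 _ _ 3) ?cabs_ge0 // -cabsX w3E cabs1.
Qed.

Let prod_w (x y : R[i]) : (x + y) * (x + w * y) * (x + w ^+ 2 * y) = x ^+ 3 + y ^+ 3.
Proof.
have -> : (x + y) * (x + w * y) * (x + w ^+ 2 * y) = x ^+ 3 +
  x * y * (x + w * y) * (1 + w + w ^+ 2) + w ^+ 3 * y ^+ 3 by ring.
by rewrite w_cubic w3E; ring.
Qed.

(** If 3 does not divide j, the three factors of exponent j multiply to 1 - p^(3j); otherwise they
    coincide and give a cube. The factor [qfact (p ^+ 9) N] restores the missing multiples of 3 on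
    the right. *)
Lemma qfact_cube p N :
  qfact p (3 * N) * qfact (w * p) (3 * N) * qfact (w ^+ 2 * p) (3 * N) *
    qfact (p ^+ 9) N =
  qfact (p ^+ 3) (3 * N) * qfact (p ^+ 3) N ^+ 3.
Proof.
elim: N => [|N ih]; first by rewrite muln0 !qfact0; ring.
have -> : (3 * N.+1 = (3 * N).+3)%N by lia.
rewrite !qfactS.
have e0 (c : R[i]) : c ^+ 3 = 1 -> (c * p) ^+ (3 * N) = p ^+ (3 * N).
  by move=> c3; rewrite exprMn exprM c3 expr1n mul1r.
have ew : (w * p) ^+ (3 * N) = p ^+ (3 * N) by exact: e0.
have ew2 : (w ^+ 2 * p) ^+ (3 * N) = p ^+ (3 * N).
  by apply: e0; rewrite exprAC w3E expr1n.
set Y := p ^+ (3 * N) in ew ew2.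
have e3 : (p ^+ 3) ^+ (3 * N) = Y ^+ 3 by rewrite exprAC.
have e3' : (p ^+ 3) ^+ N = Y by rewrite -exprM.
have e9 : (p ^+ 9) ^+ N = Y ^+ 3 by rewrite -!exprM; congr (_ ^+ _); lia.
have s1 (x : R[i]) : x ^+ (3 * N).+1 = x * x ^+ (3 * N) by rewrite exprS.
have s2 (x : R[i]) : x ^+ (3 * N).+2 = x ^+ 2 * x ^+ (3 * N) by rewrite -exprD.
have s3 (x : R[i]) : x ^+ (3 * N).+3 = x ^+ 3 * x ^+ (3 * N) by rewrite -exprD.
have s4 (x : R[i]) : x ^+ N.+1 = x * x ^+ N by rewrite exprS.
rewrite !s3 !s2 !s1 !s4 ew ew2 e3 e3' e9 -/Y.
have h1 := prod_w 1 (- (p * Y)); have h2 := prod_w 1 (- (p ^+ 2 * Y)).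
move: ih; set A := qfact p _; set B := qfact (w * p) _.
set C := qfact (w ^+ 2 * p) _; set D := qfact (p ^+ 9) _.
set G := qfact (p ^+ 3) (3 * N); set H := qfact _ _ => ih.
have w4 : w ^+ 4 = w by rewrite (exprS w 3) w3E mulr1.
have w6 : w ^+ 6 = 1 by rewrite (exprM w 3 2) w3E expr1n.
have -> : A * (1 - p * Y) * (1 - p ^+ 2 * Y) * (1 - p ^+ 3 * Y) *
  (B * (1 - w * p * Y) * (1 - (w * p) ^+ 2 * Y) * (1 - (w * p) ^+ 3 * Y)) *
  (C * (1 - w ^+ 2 * p * Y) * (1 - (w ^+ 2 * p) ^+ 2 * Y) *
    (1 - (w ^+ 2 * p) ^+ 3 * Y)) * (D * (1 - p ^+ 9 * Y ^+ 3)) =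
  A * B * C * D * ((1 + - (p * Y)) * (1 + w * - (p * Y)) * (1 + w ^+ 2 * - (p * Y))) *
  ((1 + - (p ^+ 2 * Y)) * (1 + w ^+ 4 * - (p ^+ 2 * Y)) * (1 + w ^+ 2 * - (p ^+ 2 * Y))) *
  ((1 - p ^+ 3 * Y) * (1 - w ^+ 3 * p ^+ 3 * Y) * (1 - w ^+ 6 * p ^+ 3 * Y)) *
  (1 - (p ^+ 3 * Y) ^+ 3) by ring.
by rewrite w4 w6 w3E h1 h2 ih; ring.
Qed.

Lemma euler_cube p : cabs p <= 1 / 4 ->
  euler p * euler (w * p) * euler (w ^+ 2 * p) =
  euler (p ^+ 3) ^+ 4 / euler (p ^+ 9).
Proof.
move=> hp; have hX n : cabs (p ^+ n.+1) <= 1 / 4 by exact: cabsX_small.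
have hw : cabs (w * p) <= 1 / 4 by rewrite cabsM cabs_w mul1r.
have hw2 : cabs (w ^+ 2 * p) <= 1 / 4 by rewrite cabsM cabsX cabs_w expr1n mul1r.
have sub u (l : R[i]) : u @ \oo --> l -> (fun N => u (3 * N)%N) @ \oo --> l.
  by apply: cvgn_subseq => n; lia.
have L := cvgn_mul (cvgn_mul (cvgn_mul (sub _ _ (euler_cvg hp))
  (sub _ _ (euler_cvg hw))) (sub _ _ (euler_cvg hw2))) (euler_cvg (hX 8)).
have c3 := euler_cvg (hX 2).
have M := cvgn_mul (sub _ _ c3) (cvgn_mul c3 (cvgn_mul c3 c3)).
have E := cvgn_unique (cvgn_ext (qfact_cube p) L) M.
have e9 : euler (p ^+ 9) != 0 := euler_neq0 (hX 8).
by apply: (mulIf e9); rewrite divfK //.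
Qed.

(** The product of the dissections at p, w p, w^2 p. Their two theta quotients depend only on p^3,
    so the right-hand sides multiply to a sum of two cubes. On the left, squaring merely permutes w
    and w^2, and [euler_cube] applies at p and at p^2. *)
Lemma psi_cubic p : cabs p <= 1 / 4 ->
  (euler (p ^+ 6) ^+ 4 / euler (p ^+ 18)) ^+ 2 /
    (euler (p ^+ 3) ^+ 4 / euler (p ^+ 9)) =
  (euler (p ^+ 6) * euler (p ^+ 9) ^+ 2 / (euler (p ^+ 3) * euler (p ^+ 18))) ^+ 3 +
  p ^+ 3 * (euler (p ^+ 18) ^+ 2 / euler (p ^+ 9)) ^+ 3.
Proof.
move=> hp; have hX n : cabs (p ^+ n.+1) <= 1 / 4 by exact: cabsX_small.
have hw : cabs (w * p) <= 1 / 4 by rewrite cabsM cabs_w mul1r.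
have hw2 : cabs (w ^+ 2 * p) <= 1 / 4 by rewrite cabsM cabsX cabs_w expr1n mul1r.
have k0 (c : R[i]) n : c ^+ 3 = 1 -> (c * p) ^+ (3 * n) = p ^+ (3 * n).
  by move=> c3; rewrite exprMn exprM c3 expr1n mul1r.
have w23 : (w ^+ 2) ^+ 3 = 1 by rewrite exprAC w3E expr1n.
have d0 := psi_dissection hp; have d1 := psi_dissection hw.
have d2 := psi_dissection hw2.
rewrite (k0 w 1 w3E) (k0 w 2 w3E) (k0 w 3 w3E) (k0 w 6 w3E) in d1.
rewrite (k0 _ 1 w23) (k0 _ 2 w23) (k0 _ 3 w23) (k0 _ 6 w23) in d2.
have q1 := euler_cube hp; have q2 := euler_cube (hX 1).
rewrite -!exprM -[(2 * 3)%N]/6%N -[(2 * 9)%N]/18%N in q2.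
have e1 : (w * p) ^+ 2 = w ^+ 2 * p ^+ 2 by rewrite exprMn.
have e2 : (w ^+ 2 * p) ^+ 2 = w * p ^+ 2.
  by rewrite exprMn -exprM (exprS w 3) w3E mulr1.
rewrite e1 in d1; rewrite e2 in d2.
apply: etrans (congr2 (fun x y => y ^+ 2 / x) (esym q1) (esym q2)) _.
have e3 (A B : R[i]) : A ^+ 3 + p ^+ 3 * B ^+ 3 =
    (A + p * B) * (A + w * p * B) * (A + w ^+ 2 * p * B).
  have -> : A ^+ 3 + p ^+ 3 * B ^+ 3 = A ^+ 3 + (p * B) ^+ 3 by ring.
  by rewrite -prod_w; ring.
rewrite e3 -d0 -d1 -d2.
move: (euler p) (euler (w * p)) (euler (w ^+ 2 * p)) => a b c.
move: (euler (p ^+ 2)) (euler (w * p ^+ 2)) (euler (w ^+ 2 * p ^+ 2)) => d e f.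
by rewrite !invfM; ring.
Qed.

Lemma phi_cubic p : cabs p <= 1 / 4 ->
  (euler (p ^+ 3) ^+ 4 / euler (p ^+ 9)) ^+ 2 /
    (euler (p ^+ 6) ^+ 4 / euler (p ^+ 18)) =
  (euler (p ^+ 9) ^+ 2 / euler (p ^+ 18)) ^+ 3 - 8 * p ^+ 3 *
  (euler (p ^+ 3) * euler (p ^+ 18) ^+ 2 / (euler (p ^+ 6) * euler (p ^+ 9))) ^+ 3.
Proof.
move=> hp; have hX n : cabs (p ^+ n.+1) <= 1 / 4 by exact: cabsX_small.
have hw : cabs (w * p) <= 1 / 4 by rewrite cabsM cabs_w mul1r.
have hw2 : cabs (w ^+ 2 * p) <= 1 / 4 by rewrite cabsM cabsX cabs_w expr1n mul1r.
have k0 (c : R[i]) n : c ^+ 3 = 1 -> (c * p) ^+ (3 * n) = p ^+ (3 * n).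
  by move=> c3; rewrite exprMn exprM c3 expr1n mul1r.
have w23 : (w ^+ 2) ^+ 3 = 1 by rewrite exprAC w3E expr1n.
have d0 := phi_dissection hp; have d1 := phi_dissection hw.
have d2 := phi_dissection hw2.
rewrite (k0 w 1 w3E) (k0 w 2 w3E) (k0 w 3 w3E) (k0 w 6 w3E) in d1.
rewrite (k0 _ 1 w23) (k0 _ 2 w23) (k0 _ 3 w23) (k0 _ 6 w23) in d2.
have q1 := euler_cube hp; have q2 := euler_cube (hX 1).
rewrite -!exprM -[(2 * 3)%N]/6%N -[(2 * 9)%N]/18%N in q2.
have e1 : (w * p) ^+ 2 = w ^+ 2 * p ^+ 2 by rewrite exprMn.
have e2 : (w ^+ 2 * p) ^+ 2 = w * p ^+ 2.
  by rewrite exprMn -exprM (exprS w 3) w3E mulr1.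
rewrite e1 in d1; rewrite e2 in d2.
apply: etrans (congr2 (fun x y => y ^+ 2 / x) (esym q2) (esym q1)) _.
have e3 (A B : R[i]) : A ^+ 3 - 8 * p ^+ 3 * B ^+ 3 =
    (A - 2 * p * B) * (A - 2 * (w * p) * B) * (A - 2 * (w ^+ 2 * p) * B).
  have -> : A ^+ 3 - 8 * p ^+ 3 * B ^+ 3 = A ^+ 3 + (- (2 * p * B)) ^+ 3 by ring.
  by rewrite -prod_w; ring.
rewrite e3 -d0 -d1 -d2.
move: (euler p) (euler (w * p)) (euler (w ^+ 2 * p)) => a b c.
move: (euler (p ^+ 2)) (euler (w * p ^+ 2)) (euler (w ^+ 2 * p ^+ 2)) => d e f.
by rewrite !invfM; ring.
Qed.

End CubicIdentities.

Section LevelSix.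
Variable R : realType.
Implicit Types q : R[i].

Definition lev6_s q : R[i] :=
  q * euler (q ^+ 2) * euler (q ^+ 6) ^+ 5 / (euler q ^+ 5 * euler (q ^+ 3)).

Lemma cubic_root_ex : exists w : R[i], 1 + w + w ^+ 2 = 0.
Proof.
exists ((sqrtc (- 3) - 1) / 2).
have := sqr_sqrtc (- 3 : R[i]); move: (sqrtc _) => s hs.
have -> : 1 + (s - 1) / 2 + ((s - 1) / 2) ^+ 2 = (s ^+ 2 + 3) / 4 by field.
by rewrite hs addNr mul0r.
Qed.

(** The bound 1/64 gives |p| <= 1/4 for a cube root p of q. With u, v, x, y for E_1, E_2, E_3, E_6,
    [phi_cubic] times v^4 x^2 / (u^8 y) is the formula for 1 + 8 s, and [psi_cubic] times v x^2 /
    (u^5 y) says that the two quotients claimed differ by s. *)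
Lemma lev6_identities q : cabs q <= 1 / 64 ->
  1 + 8 * lev6_s q = euler (q ^+ 2) ^+ 4 * euler (q ^+ 3) ^+ 8 /
                     (euler q ^+ 8 * euler (q ^+ 6) ^+ 4) /\
  1 + 9 * lev6_s q = euler (q ^+ 2) ^+ 9 * euler (q ^+ 3) ^+ 3 /
                     (euler q ^+ 9 * euler (q ^+ 6) ^+ 3).
Proof.
move=> hq; pose p := 3.-root q.
have pq : p ^+ 3 = q by rewrite /p rootCK.
have hp : cabs p <= 1 / 4.
  by rewrite -(@ler_pXn2r _ 3) ?nnegrE ?cabs_ge0 -?cabsX ?pq //; lra.
have [w hw] := cubic_root_ex.
have psi := psi_cubic hw hp; have phi := phi_cubic hw hp.
have eX n : (0 < n)%N -> euler (q ^+ n) != 0.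
  case: n => // n _; apply: euler_neq0; rewrite -pq -exprM mulnS.
  exact: cabsX_small.
have e1 := eX 1 isT; have e2 := eX 2 isT; have e3 := eX 3 isT.
have e6 := eX 6 isT.
have p6 : p ^+ 6 = q ^+ 2 by rewrite -pq -exprM.
have p9 : p ^+ 9 = q ^+ 3 by rewrite -pq -exprM.
have p18 : p ^+ 18 = q ^+ 6 by rewrite -pq -exprM.
rewrite pq p6 p9 p18 in psi phi; rewrite expr1 in e1; rewrite /lev6_s.
move: psi phi e1 e2 e3 e6.
move: (euler q) (euler (q ^+ 2)) (euler (q ^+ 3)) (euler (q ^+ 6)) => u v x y.
move=> /eqP; rewrite -subr_eq0 => /eqP psi /eqP; rewrite -subr_eq0 => /eqP phi.
move=> u0 v0 x0 y0.
suff h8 : 1 + 8 * (q * v * y ^+ 5 / (u ^+ 5 * x)) =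
    v ^+ 4 * x ^+ 8 / (u ^+ 8 * y ^+ 4).
  split=> //; apply/eqP; rewrite -subr_eq0.
  have -> : 1 + 9 * (q * v * y ^+ 5 / (u ^+ 5 * x)) =
    v ^+ 4 * x ^+ 8 / (u ^+ 8 * y ^+ 4) + q * v * y ^+ 5 / (u ^+ 5 * x).
    by rewrite -h8; ring.
  apply/eqP; rewrite -[RHS](mulr0 (- (v * x ^+ 2 / (u ^+ 5 * y)))) -psi.
  by field; rewrite ?u0 ?v0 ?x0 ?y0.
apply/eqP; rewrite -subr_eq0; apply/eqP.
rewrite -[RHS](mulr0 (v ^+ 4 * x ^+ 2 / (u ^+ 8 * y))) -phi.
by field; rewrite ?u0 ?v0 ?x0 ?y0.
Qed.

End LevelSix.

(** * Polar form, principal roots and real powers of q *)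

Section Polar.
Variable R : realType.
Implicit Types (z r tau : R[i]) (t : R).
Local Open Scope complex_scope.

Lemma cexpi t : cexp (0 +i* t) = cos t +i* sin t.
Proof. by rewrite /cexp /= expR0 mul1r. Qed.

Lemma cexpE t u : cexp (t +i* u) = (expR t)%:C * cexp (0 +i* u).
Proof. by rewrite cexpi. Qed.

Lemma cexpD z r : cexp (z + r) = cexp z * cexp r.
Proof.
case: z r => [a b] [c d]; have -> : (a +i* b) + (c +i* d) = (a + c) +i* (b + d) by [].
rewrite (cexpE (a + c)) (cexpE a) (cexpE c) expRD rmorphM /= [RHS]mulrACA; congr (_ * _).
rewrite !cexpi cosD sinD; apply/eqP; rewrite eq_complex /=.
by apply/andP; split; apply/eqP; ring.
Qed.

Lemma cexpX z n : cexp z ^+ n = cexp (n%:R * z).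
Proof.
elim: n => [|n ih]; first by rewrite expr0 mul0r /cexp /= expR0 cos0 sin0 mul1r.
by rewrite exprS ih -cexpD -natr1 mulrDl mul1r addrC.
Qed.

Lemma cabs_cis t : cabs (cexp (0 +i* t)) = 1.
Proof.
apply/eqP; rewrite -(@pexpr_eq1 _ _ 2) ?cabs_ge0 // cabs_sqr cexpi /=.
by rewrite cos2Dsin2.
Qed.

Lemma cabs_real t : 0 <= t -> cabs t%:C = t.
Proof.
by move=> t0; rewrite /cabs ger0_norm // ler0c.
Qed.

Lemma cabs_cexp z : cabs (cexp z) = expR (complex.Re z).
Proof.
by case: z => a b; rewrite cexpE cabsM cabs_cis mulr1 cabs_real ?ltW ?expR_gt0.
Qed.

Lemma cexp_neq0 z : cexp z != 0.
Proof. by rewrite -cabs_gt0 cabs_cexp expR_gt0. Qed.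

Let Re_cabs_itv z : -1 <= complex.Re z / cabs z <= 1.
Proof.
have [->|z0] := eqVneq z 0; first by rewrite /= mul0r; apply/andP; split; lra.
have z1 : 0 < cabs z by rewrite cabs_gt0.
have := normr_Re_le z; rewrite ler_norml => /andP[h1 h2].
by rewrite ler_pdivlMr // ler_pdivrMr // mulN1r mul1r h1 h2.
Qed.

Lemma polar z : z = (cabs z)%:C * cexp (0 +i* carg z).
Proof.
have [->|z0] := eqVneq z 0; first by rewrite cabs0 mul0r.
have z1 : 0 < cabs z by rewrite cabs_gt0.
have z2 : cabs z != 0 by rewrite gt_eqF.
have hi := Re_cabs_itv z.
have hs : sin (acos (complex.Re z / cabs z)) = `|complex.Im z| / cabs z.
  rewrite sin_acos // -[RHS]ger0_norm ?divr_ge0 ?cabs_ge0 // -sqrtr_sqr.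
  congr Num.sqrt; rewrite !expr_div_n real_normK ?num_real //.
  have : cabs z ^+ 2 != 0 by rewrite expf_neq0 // gt_eqF.
  have := cabs_sqr z; move: (cabs z ^+ 2) => m -> m0.
  by rewrite -{1}[1](mulfV m0) -mulrBl addrC addKr.
rewrite cexpi /carg; case: ifP => im; rewrite ?cosN ?sinN acosK ?in_itv //= hs.
  rewrite ger0_norm //; apply/eqP; rewrite eq_complex /= !mul0r subr0 addr0.
  by rewrite !(mulrC (cabs z)) !divfK ?eqxx.
rewrite ltr0_norm ?ltNge ?im //; apply/eqP; rewrite eq_complex /=.
rewrite !mul0r subr0 addr0 mulNr opprK.
by rewrite !(mulrC (cabs z)) !divfK ?eqxx.
Qed.

Lemma carg_polar (m t : R) : 0 < m -> - pi < t < pi ->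
  carg (m%:C * cexp (0 +i* t)) = t.
Proof.
move=> m0 /andP[t1 t2]; rewrite /carg cabsM cabs_cis mulr1 (cabs_real (ltW m0)).
rewrite cexpi /= !mul0r subr0 addr0 [m * cos t]mulrC mulfK ?gt_eqF //.
rewrite pmulr_rge0 //; have [t0|t0] := leP 0 t.
  by rewrite sin_ge0_pi ?t0 ?ltW // cosK // in_itv /= t0 ltW.
have -> : (0 <= sin t) = false.
  by apply/negbTE; rewrite -ltNge -oppr_gt0 -sinN sin_gt0_pi //; apply/andP; split; lra.
by rewrite cosKN ?opprK //; apply/andP; split; lra.
Qed.

(** The inequality expresses |arg r| < pi / k through real parts. Then k arg r stays in ]-pi, pi[,
    so it is the principal argument of r^k and no branch cut is crossed. *)
Lemma croot_exp (k : nat) r : (0 < k)%N ->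
  cos (pi / k%:R) * cabs r < complex.Re r -> croot k (r ^+ k) = r.
Proof.
move=> k0 hr; have k1 : 0 < k%:R :> R by rewrite ltr0n.
have k2 : k%:R != 0 :> R by rewrite gt_eqF.
have r0 : 0 < cabs r.
  rewrite cabs_gt0; apply/eqP => r0; move: hr.
  by rewrite r0 cabs0 mulr0 /= ltxx.
have hi := Re_cabs_itv r; have hp := polar r.
have ht : - (pi / k%:R) < carg r < pi / k%:R.
  have : acos (complex.Re r / cabs r) < pi / k%:R.
    rewrite -ltr_cos ?in_itv /= ?acos_ge0 ?acos_lepi //; last first.
      rewrite divr_ge0 ?pi_ge0 ?ler0n //= ler_pdivrMr // ler_peMr ?pi_ge0 //.
      by rewrite ler1n.
    by rewrite acosK ?in_itv //= ltr_pdivlMr.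
  have := acos_ge0 hi; rewrite /carg; case: ifP => _ h1 h2.
    by rewrite h2 (lt_le_trans _ h1) // oppr_lt0 divr_gt0 // pi_gt0.
  by rewrite ltrN2 h2 /= (le_lt_trans _ (le_lt_trans h1 h2)) // oppr_le0.
have hX : r ^+ k = (cabs r ^+ k)%:C * cexp (0 +i* (k%:R * carg r)).
  rewrite {1}hp exprMn rmorphXn /= cexpX; congr (_ * cexp _).
  rewrite -(rmorph_nat (real_complex R)); apply/eqP; rewrite eq_complex /=.
  by rewrite !mul0r mulr0 subr0 addr0 !eqxx.
rewrite /croot {2}hX carg_polar ?exprn_gt0 //; last first.
  move: ht; rewrite -mulNr -!(mulrC (carg r)) ltr_pdivrMr // ltr_pdivlMr //.
rewrite cabsX -powR_mulrn ?cabs_ge0 // -powRrM mulfV // powRr1 ?cabs_ge0 //.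
by rewrite (mulrC k%:R) mulfK // -hp.
Qed.

Lemma croot2_sqr r : 0 < complex.Re r -> croot 2 (r ^+ 2) = r.
Proof. by move=> h; apply: croot_exp; rewrite // cos_pihalf mul0r. Qed.

Lemma cos_pi3 : cos (pi / 3) = 1 / 2 :> R.
Proof.
set x : R := pi / 3; have h3 : cos (x + x + x) = -1.
  by rewrite -cospi; congr cos; rewrite /x; field.
have p0 : 0 < cos x.
  apply: cos_gt0_pihalf; have := pi_gt0 R; rewrite /x => ?.
  by apply/andP; split; lra.
have := cos2Dsin2 x; move: h3; rewrite !cosD sinD.
move: p0; set c := cos x; set s := sin x => p0 h3 h1.
(* This is cos 3x = -1, that is 4 c^3 - 3 c + 1 = 0, factored; c > 0 excludes the root -1. *)
have h : (c + 1) * (2 * c - 1) ^+ 2 = 0.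
  have -> : (c + 1) * (2 * c - 1) ^+ 2 =
    (c * c - s * s) * c - (s * c + c * s) * s + 1 - 3 * c * (1 - (c ^+ 2 + s ^+ 2)) by ring.
  by rewrite h3 h1; ring.
move/eqP: h; rewrite mulf_eq0 sqrf_eq0 => /orP[/eqP|/eqP]; lra.
Qed.

(** Here Re r >= 3/4, while cos (pi / 3) |r| <= 5/8. *)
Lemma croot3_cube r : cabs (r - 1) <= 1 / 4 -> croot 3 (r ^+ 3) = r.
Proof.
move=> h; apply: croot_exp => //; rewrite cos_pi3.
have := cabs_ge_sub r 1; rewrite cabs1 => h1.
have := normr_Re_le (r - 1); have -> : complex.Re (r - 1) = complex.Re r - 1 by case: (r).
by rewrite ler_norml => /andP[h2 h3]; lra.
Qed.

Lemma qpowE (r : R) tau : qpow r tau =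
  cexp ((- (2 * pi * r * complex.Im tau)) +i* (2 * pi * r * complex.Re tau)).
Proof.
rewrite /qpow; congr cexp; case: tau => a b; apply/eqP; rewrite eq_complex /=.
by rewrite !mul0r !add0r !eqxx.
Qed.

Lemma qpowD (r s : R) tau : qpow (r + s) tau = qpow r tau * qpow s tau.
Proof.
rewrite !qpowE -cexpD; congr cexp; apply/eqP; rewrite eq_complex /=.
by apply/andP; split; apply/eqP; ring.
Qed.

Lemma qpowX (r : R) n tau : qpow r tau ^+ n = qpow (r * n%:R) tau.
Proof.
elim: n => [|n ih].
  by rewrite expr0 mulr0 qpowE /cexp /= !mulr0 !mul0r oppr0 expR0 cos0 sin0 mul1r.
by rewrite exprS ih -qpowD -natr1 mulrDr mulr1 addrC.
Qed.

Lemma qpow_neq0 (r : R) tau : qpow r tau != 0.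
Proof. exact: cexp_neq0. Qed.

Lemma qpow_double (r : R) tau : qpow r (2 * tau) = qpow (2 * r) tau.
Proof.
rewrite !qpowE; congr cexp; case: tau => a b; apply/eqP; rewrite eq_complex /=.
by apply/andP; split; apply/eqP; ring.
Qed.

Lemma qpow1_ex z : z != 0 -> exists2 tau,
  qpow 1 tau = z & complex.Im tau = - ln (cabs z) / (2 * pi).
Proof.
move=> z0; have z1 : 0 < cabs z by rewrite cabs_gt0.
have p0 : pi != 0 :> R by rewrite gt_eqF // pi_gt0.
exists ((carg z / (2 * pi)) +i* (- ln (cabs z) / (2 * pi))) => //.
rewrite qpowE /= [RHS]polar -{2}[cabs z]lnK ?posrE // -cexpE.
move: (carg z) (ln _) (pi : R) p0 => c l P p0.
apply: (congr1 (@cexp R)); apply/eqP; rewrite eq_complex /=.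
by apply/andP; split; apply/eqP; field.
Qed.

Lemma etaE m tau : eta m tau = qpow (m%:R / 24) tau * euler (qpow 1 tau ^+ m).
Proof.
rewrite /eta /euler; congr (_ * _); congr (limn _); apply/funext => n.
by apply: eq_bigr => j _; rewrite exprM.
Qed.

End Polar.

(** * Functions that are Lipschitz near 0, and their fixed points *)

Section LipschitzNearZero.
Variable R : realType.
Implicit Types (f g : R[i] -> R[i]).

Definition lip0 f := exists2 L : R, 0 <= L & exists2 d : R, 0 < d &
  forall x y, cabs x < d -> cabs y < d -> cabs (f x - f y) <= L * cabs (x - y).

Lemma lip0_near f (e : R) : lip0 f -> 0 < e ->
  \forall x \near (0 : R[i]), cabs (f x - f 0) < e.
Proof.
move=> [L L0 [d d0 h]] e0; apply/near0P.
exists (Num.min d (e / (L + 1))).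
  by rewrite lt_min d0 divr_gt0 // ltr_wpDl.
move=> x; rewrite lt_min => /andP[xd]; rewrite ltr_pdivlMr ?ltr_wpDl // => xe.
have := h x 0 xd; rewrite cabs0 subr0 => /(_ d0) h1.
by have := cabs_ge0 x; nra.
Qed.

Lemma lip0_bound f : lip0 f -> exists2 M : R, 0 <= M &
  \forall x \near (0 : R[i]), cabs (f x) <= M.
Proof.
move=> hf; exists (cabs (f 0) + 1); first by rewrite addr_ge0 ?cabs_ge0.
apply: filterS (lip0_near hf ltr01) => x hx.
by have := cabs_ge_sub (f x) (f 0); lra.
Qed.

(** With an arbitrary neighbourhood in place of a disc, side conditions such as local bounds can be
    added by [filterI]. *)
Lemma lip0P f : lip0 f <-> exists2 L : R, 0 <= L &
  exists2 P : R[i] -> Prop, (\forall x \near (0 : R[i]), P x) &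
  forall x y, P x -> P y -> cabs (f x - f y) <= L * cabs (x - y).
Proof.
split=> [[L L0 [d d0 h]]|[L L0 [P /near0P[d d0 hd] h]]].
  by exists L => //; exists (fun x => cabs x < d) => //; apply/near0P; exists d.
by exists L => //; exists d => // x y /hd px /hd py; exact: h.
Qed.

Lemma lip0_cst (c : R[i]) : lip0 (fun=> c).
Proof.
exists 0 => //; exists 1; first exact: ltr01.
by move=> x y _ _; rewrite subrr cabs0 mul0r.
Qed.

Lemma lip0_id : lip0 id.
Proof.
by exists 1 => //; exists 1; [exact: ltr01|move=> x y _ _; rewrite mul1r].
Qed.

Lemma lip0_add f g : lip0 f -> lip0 g -> lip0 (fun x => f x + g x).
Proof.
move=> /lip0P[L L0 [P hP h]] /lip0P[K K0 [Q hQ k]]; apply/lip0P.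
exists (L + K); first exact: addr_ge0.
exists (fun x => P x /\ Q x); first exact: filterI.
move=> x y [px qx] [py qy].
have -> : f x + g x - (f y + g y) = (f x - f y) + (g x - g y) by ring.
by apply: le_trans (cabsD _ _) _; rewrite mulrDl lerD // ?h ?k.
Qed.

Lemma lip0_mul f g : lip0 f -> lip0 g -> lip0 (fun x => f x * g x).
Proof.
move=> hf hg; have [M M0 hM] := lip0_bound hf; have [N N0 hN] := lip0_bound hg.
move: hf hg => /lip0P[L L0 [P hP h]] /lip0P[K K0 [Q hQ k]]; apply/lip0P.
exists (M * K + N * L); first by rewrite addr_ge0 // mulr_ge0.
exists (fun x => (P x /\ Q x) /\ (cabs (f x) <= M /\ cabs (g x) <= N)).
  by apply: filterI; apply: filterI.
move=> x y [[px qx] [mx _]] [[py qy] [_ ny]].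
have -> : f x * g x - f y * g y = f x * (g x - g y) + g y * (f x - f y) by ring.
apply: le_trans (cabsD _ _) _; rewrite !cabsM mulrDl -!mulrA.
by apply: lerD; apply: ler_pM; rewrite ?cabs_ge0 // ?h ?k.
Qed.

Lemma lip0_inv f : f 0 != 0 -> lip0 f -> lip0 (fun x => (f x)^-1).
Proof.
move=> f0 hf; have a0 : 0 < cabs (f 0) by rewrite cabs_gt0.
have hn := lip0_near hf (divr_gt0 a0 (ltr0n R 2)).
move: hf => /lip0P[L L0 [P hP h]]; apply/lip0P.
exists (4 / cabs (f 0) ^+ 2 * L).
  by rewrite mulr_ge0 // divr_ge0 // exprn_ge0 // cabs_ge0.
exists (fun x => P x /\ cabs (f x - f 0) < cabs (f 0) / 2); first exact: filterI.
move=> x y [px nx] [py ny].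
have hx2 : cabs (f 0) / 2 < cabs (f x).
  by have := cabs_ge_sub (f 0) (f x); rewrite cabsB; lra.
have hy2 : cabs (f 0) / 2 < cabs (f y).
  by have := cabs_ge_sub (f 0) (f y); rewrite cabsB; lra.
have x0 : f x != 0 by rewrite -cabs_gt0; lra.
have y0 : f y != 0 by rewrite -cabs_gt0; lra.
have -> : (f x)^-1 - (f y)^-1 = - ((f x)^-1 * (f y)^-1 * (f x - f y)).
  by move: (f x) (f y) x0 y0 => u v u0 v0; field; rewrite ?u0 ?v0.
rewrite cabsN !cabsM !cabsV -mulrA -[X in _ <= X]mulrA.
have -> : 4 / cabs (f 0) ^+ 2 = (cabs (f 0) / 2)^-1 * (cabs (f 0) / 2)^-1.
  by move: (cabs (f 0)) a0 => a a0; field; rewrite gt_eqF.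
rewrite mulrA; apply: ler_pM; rewrite ?cabs_ge0 ?mulr_ge0 ?invr_ge0 ?cabs_ge0 ?h //.
apply: ler_pM; rewrite ?invr_ge0 ?cabs_ge0 // lef_pV2 ?posrE ?divr_gt0 ?ltW //;
  exact: lt_trans (divr_gt0 a0 (ltr0n R 2)) _.
Qed.

Lemma lip0_exp f n : lip0 f -> lip0 (fun x => f x ^+ n).
Proof.
move=> hf; elim: n => [|n ih].
  rewrite (_ : (fun x => _) = fun=> 1); first exact: lip0_cst.
  by apply/funext => x; rewrite expr0.
rewrite (_ : (fun x => _) = (fun x => f x * f x ^+ n)); first exact: lip0_mul.
by apply/funext => x; rewrite exprS.
Qed.

Lemma lip0_euler n : lip0 (fun q => euler (q ^+ n.+1)).
Proof.
apply/lip0P; exists 8 => //; exists (fun q => cabs q <= 1 / 4).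
  by apply/near0P; exists (1 / 4) => [|x /ltW //]; lra.
move=> x y hx hy; apply: le_trans (euler_lipschitz (cabsX_small n hx) (cabsX_small n hy)) _.
rewrite ler_pM2l //; apply: le_trans (expr_lipschitz n hx hy) _.
by rewrite ler_piMl ?cabs_ge0 //; case/andP: (half_itv R n).
Qed.

(* Banach iteration q |-> x V(q), a contraction once x is small. *)
Lemma lip0_fixpoint f : lip0 f -> exists2 M : R, 0 <= M &
  \forall x \near (0 : R[i]), exists2 q, cabs q <= M * cabs x & q = x * f q.
Proof.
move=> hf; have [M M0 /near0P[b b0 hM]] := lip0_bound hf.
move: hf => [L L0 [d d0 h]]; exists M => //.
pose r := Num.min b d; have r0 : 0 < r by rewrite lt_min b0 d0.
(* The first bound keeps the iterates, of modulus at most M |x|, in the disc where the estimates on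
   f hold; the second makes the contraction ratio at most 1/2. *)
apply/near0P; exists (Num.min (r / (M + 1)) (1 / 2 / (L + 1))).
  by rewrite lt_min !divr_gt0 ?ltr_wpDl //; lra.
move=> x; rewrite lt_min !ltr_pdivlMr ?ltr_wpDl // => /andP[x1 x2].
have xM : M * cabs x < r by have := cabs_ge0 x; lra.
have xL : cabs x * L <= 1 / 2 by have := cabs_ge0 x; lra.
pose u n := iter n (fun q => x * f q) 0.
have uS n : u n.+1 = x * f (u n) by [].
have uM n : cabs (u n) <= M * cabs x.
  elim: n => [|n ih]; first by rewrite cabs0 mulr_ge0 ?cabs_ge0.
  rewrite uS cabsM mulrC ler_wpM2r ?cabs_ge0 //; apply: hM.
  by move: (le_lt_trans ih xM); rewrite lt_min => /andP[].
have uk y z : cabs y <= M * cabs x -> cabs z <= M * cabs x ->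
    cabs (x * f y - x * f z) <= 1 / 2 * cabs (y - z).
  move=> hy hz; rewrite -mulrBr cabsM.
  have : cabs (f y - f z) <= L * cabs (y - z).
    apply: h; [move: (le_lt_trans hy xM)|move: (le_lt_trans hz xM)];
      by rewrite lt_min => /andP[].
  move/(ler_wpM2l (cabs_ge0 x)) => k1; apply: le_trans k1 _.
  by rewrite mulrA ler_wpM2r ?cabs_ge0.
have uC n : cabs (u n.+1 - u n) <= M * cabs x * (1 / 2) ^+ n.
  elim: n => [|n ih]; first by rewrite expr0 mulr1 subr0.
  rewrite (uS n.+1) {2}(uS n); apply: le_trans (uk _ _ (uM _) (uM _)) _.
  by rewrite exprS; lra.
have [q hq] := complex_geometric_cauchy uC.
have cq := cvgn_cabs_geometric hq.
have qM : cabs q <= M * cabs x by exact: limn_cabs cq uM.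
exists q => //; apply/eqP; rewrite -subr_eq0 -cabs_eq0; apply/eqP/le_anti.
rewrite cabs_ge0 andbT; apply/ler_addgt0Pr => e e0; rewrite add0r.
have e2 : 0 < e / 2 by rewrite divr_gt0.
have /cvgn_cabsP/(_ _ e2)[N _ hN] := cq.
have h1 := hN N (leqnn N); have h2 := hN N.+1 (leqnSn N).
have := cabs_dist q (u N.+1) (x * f q).
have := uk _ _ (uM N) qM; rewrite -uS; rewrite /= in h1 h2.
by rewrite (cabsB q (u N.+1)); lra.
Qed.

End LipschitzNearZero.

(** * Removal of the fractional powers of q from the eta quotients *)

Lemma cancel_div (F : fieldType) (a b c : F) : a != 0 -> (a * b) / (a * c) = b / c.
Proof. by move=> a0; rewrite invfM mulrACA mulfV // mul1r. Qed.

Section EtaQuotients.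
Variable R : realType.
Implicit Types (tau q : R[i]).

Let qpow_eq (r t : R) tau : r = t -> qpow r tau = qpow t tau.
Proof. by move=> ->. Qed.

Let etaX m n tau : eta m tau ^+ n =
  qpow (m%:R / 24 * n%:R) tau * euler (qpow 1 tau ^+ m) ^+ n.
Proof. by rewrite etaE -qpowX -exprMn. Qed.

(** In this and the next three lemmas the exponents of q balance: 12 (3 - 1) / 24 = 1 for X3, 2 (1 +
    3) / 24 = 1/3 for Z3, 12 (1 + 6 - 2 - 3) / 24 = 1 for X6 and (1 + 2 + 3 + 6) / 24 = 1/2 for Z6.
    The fractional ones cancel against [qroot]. *)
Lemma X3E tau (q := qpow 1 tau) :
  X3 tau = let w := q * (euler (q ^+ 3) ^+ 12 / euler q ^+ 12) in
           w / (1 + 27 * w) ^+ 2.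
Proof.
rewrite /X3 !etaX -/q expr1.
have -> : qpow (3%:R / 24 * 12%:R) tau = qpow (1%:R / 24 * 12%:R) tau * q.
  by rewrite -qpowD; apply: qpow_eq; lra.
have := qpow_neq0 (1%:R / 24 * 12%:R) tau.
move: (qpow _ tau) (euler (q ^+ 3)) (euler q) => Q x u Q0 /=.
by have -> : Q * q * x ^+ 12 / (Q * u ^+ 12) = q * (x ^+ 12 / u ^+ 12);
  first by rewrite -[Q * q * _]mulrA cancel_div // mulrA.
Qed.

Lemma Z3E tau (q := qpow 1 tau) :
  Z3 tau = euler q ^+ 2 * euler (q ^+ 3) ^+ 2 / croot 3 (X3 tau / q).
Proof.
rewrite /Z3 /qroot -/q; move: (croot 3 _) => c.
rewrite !etaX -/q expr1.
have -> : qpow (3%:R^-1) tau = qpow (1%:R / 24 * 2%:R) tau * qpow (3%:R / 24 * 2%:R) tau.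
  by rewrite -qpowD; apply: qpow_eq; lra.
have := qpow_neq0 (1%:R / 24 * 2%:R) tau; have := qpow_neq0 (3%:R / 24 * 2%:R) tau.
move: (qpow (3%:R / _ * _) tau) (qpow (1%:R / _ * _) tau).
move: (euler (q ^+ 3)) (euler q) => x u P Q P0 Q0.
have -> : Q * u ^+ 2 * (P * x ^+ 2) = Q * P * (u ^+ 2 * x ^+ 2) by ring.
by rewrite cancel_div // mulf_neq0.
Qed.

Lemma X6E tau (q := qpow 1 tau) :
  X6 tau = let w := q * (euler q ^+ 12 * euler (q ^+ 6) ^+ 12 /
                        (euler (q ^+ 2) ^+ 12 * euler (q ^+ 3) ^+ 12)) in
           w / (1 - w) ^+ 2.
Proof.
rewrite /X6 !etaX -/q expr1.
have e : qpow (1%:R / 24 * 12%:R) tau * qpow (6%:R / 24 * 12%:R) tau =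
    qpow (2%:R / 24 * 12%:R) tau * qpow (3%:R / 24 * 12%:R) tau * q.
  by rewrite -!qpowD; apply: qpow_eq; lra.
have := qpow_neq0 (2%:R / 24 * 12%:R) tau; have := qpow_neq0 (3%:R / 24 * 12%:R) tau.
move: e; move: (qpow (1%:R / _ * _) tau) (qpow (6%:R / _ * _) tau).
move: (qpow (2%:R / _ * _) tau) (qpow (3%:R / _ * _) tau).
move: (euler (q ^+ 3)) (euler (q ^+ 2)) (euler (q ^+ 6)) (euler q).
move=> x v y u Q P S T e P0 Q0.
have -> : S * u ^+ 12 * (T * y ^+ 12) =
  Q * P * (q * (u ^+ 12 * y ^+ 12)).
  by rewrite mulrACA e; ring.
have -> : Q * v ^+ 12 * (P * x ^+ 12) = Q * P * (v ^+ 12 * x ^+ 12) by ring.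
by rewrite cancel_div ?mulf_neq0 // (mulrA q (u ^+ 12 * y ^+ 12)).
Qed.

Lemma Z6E tau (q := qpow 1 tau) :
  Z6 tau = euler q * euler (q ^+ 2) * euler (q ^+ 3) * euler (q ^+ 6) /
           croot 2 (X6 tau / q).
Proof.
rewrite /Z6 /qroot -/q; move: (croot 2 _) => c.
rewrite !etaE -/q expr1.
have -> : qpow (2%:R^-1) tau = qpow (1%:R / 24) tau * qpow (2%:R / 24) tau *
    qpow (3%:R / 24) tau * qpow (6%:R / 24) tau.
  by rewrite -!qpowD; apply: qpow_eq; lra.
have := qpow_neq0 (1%:R / 24) tau; have := qpow_neq0 (2%:R / 24) tau.
have := qpow_neq0 (3%:R / 24) tau; have := qpow_neq0 (6%:R / 24) tau.
move: (qpow (1%:R / _) tau) (qpow (6%:R / _) tau).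
move: (qpow (2%:R / _) tau) (qpow (3%:R / _) tau).
move: (euler (q ^+ 3)) (euler (q ^+ 2)) (euler (q ^+ 6)) (euler q).
move=> x v y u Q P S T T0 P0 Q0 S0.
have -> : S * u * (Q * v) * (P * x) * (T * y) = S * Q * P * T * (u * v * x * y) by ring.
by rewrite cancel_div // !mulf_neq0.
Qed.

End EtaQuotients.

(** * Rational parametrisation of all quantities by [s] *)

Section LevelSixAlgebra.
Variables (F : fieldType) (q u v x y s D : F).
Hypotheses (u0 : u != 0) (v0 : v != 0) (x0 : x != 0) (y0 : y != 0).
Hypothesis hs : s = q * v * y ^+ 5 / (u ^+ 5 * x).
Hypothesis hD : D = 1 + 16 * s + 72 * s ^+ 2.
Hypothesis h8 : 1 + 8 * s = v ^+ 4 * x ^+ 8 / (u ^+ 8 * y ^+ 4).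
Hypothesis h9 : 1 + 9 * s = v ^+ 9 * x ^+ 3 / (u ^+ 9 * y ^+ 3).
Hypotheses (D0 : D != 0) (s12 : 1 + 12 * s != 0) (s6 : 1 + 6 * s != 0).

Lemma lev6_s_neq0 : q != 0 -> s != 0.
Proof. by move=> q0; rewrite hs !(mulf_neq0, invr_eq0, expf_neq0). Qed.

Lemma lev6_s9_neq0 : 1 + 9 * s != 0.
Proof. by rewrite h9 !(mulf_neq0, invr_eq0, expf_neq0). Qed.

Lemma lev6_s8_neq0 : 1 + 8 * s != 0.
Proof. by rewrite h8 !(mulf_neq0, invr_eq0, expf_neq0). Qed.

Let s8 := lev6_s8_neq0.
Let s9 := lev6_s9_neq0.
Let nz := (u0, v0, x0, y0).

Lemma lev6_w3 : q * (x ^+ 12 / u ^+ 12) = s * (1 + 8 * s) ^+ 2 / (1 + 9 * s).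
Proof. by rewrite h8 h9 hs; field; rewrite ?nz. Qed.

Lemma lev6_w3_sqr :
  q ^+ 2 * (y ^+ 12 / v ^+ 12) = s ^+ 2 * (1 + 8 * s) / (1 + 9 * s) ^+ 2.
Proof. by rewrite h8 h9 hs; field; rewrite ?nz. Qed.

Lemma lev6_w6 : q * (u ^+ 12 * y ^+ 12 / (v ^+ 12 * x ^+ 12)) =
  s / ((1 + 8 * s) * (1 + 9 * s)).
Proof. by rewrite h8 h9 hs; field; rewrite ?nz. Qed.

Lemma lev6_X3 w : w = q * (x ^+ 12 / u ^+ 12) ->
  w / (1 + 27 * w) ^+ 2 = s * (1 + 8 * s) ^+ 2 * (1 + 9 * s) / (1 + 12 * s) ^+ 6.
Proof.
move=> ->; rewrite lev6_w3; move: s9 s12; generalize s => t t9 t12.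
have -> : 1 + 27 * (t * (1 + 8 * t) ^+ 2 / (1 + 9 * t)) =
  (1 + 12 * t) ^+ 3 / (1 + 9 * t) by field.
by field; rewrite t9 t12.
Qed.

Lemma lev6_X3_sqr w : w = q ^+ 2 * (y ^+ 12 / v ^+ 12) ->
  w / (1 + 27 * w) ^+ 2 = s ^+ 2 * (1 + 8 * s) * (1 + 9 * s) ^+ 2 / (1 + 6 * s) ^+ 6.
Proof.
move=> ->; rewrite lev6_w3_sqr; move: s9 s6; generalize s => t t9 t6.
have -> : 1 + 27 * (t ^+ 2 * (1 + 8 * t) / (1 + 9 * t) ^+ 2) =
  (1 + 6 * t) ^+ 3 / (1 + 9 * t) ^+ 2 by field.
by field; rewrite t9 t6.
Qed.

Lemma lev6_X6 w : w = q * (u ^+ 12 * y ^+ 12 / (v ^+ 12 * x ^+ 12)) ->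
  w / (1 - w) ^+ 2 = s * (1 + 8 * s) * (1 + 9 * s) / D ^+ 2.
Proof.
move=> ->; rewrite lev6_w6; move: D0 s8 s9; rewrite hD; generalize s => t d0 t8 t9.
have -> : 1 - t / ((1 + 8 * t) * (1 + 9 * t)) =
  (1 + 16 * t + 72 * t ^+ 2) / ((1 + 8 * t) * (1 + 9 * t)).
  by field; rewrite t8 t9.
by field; rewrite t8 t9 d0.
Qed.

(** The eta quotients behind s, 1 + 8 s and 1 + 9 s combine to q times a cube, which yields the root
    in [Z3] explicitly. The next two lemmas do the same for Z3(2 tau) and [Z6]. *)
Lemma lev6_root3 : s * (1 + 8 * s) ^+ 2 * (1 + 9 * s) / (1 + 12 * s) ^+ 6 =
  q * (v ^+ 6 * x ^+ 6 / (u ^+ 10 * y ^+ 2 * (1 + 12 * s) ^+ 2)) ^+ 3.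
Proof.
move: s12; generalize (1 + 12 * s) => t t0; rewrite h8 h9 hs.
by field; rewrite ?nz t0.
Qed.

Lemma lev6_root3_sqr : s ^+ 2 * (1 + 8 * s) * (1 + 9 * s) ^+ 2 / (1 + 6 * s) ^+ 6 =
  q ^+ 2 * (v ^+ 8 * x ^+ 4 / (u ^+ 12 * (1 + 6 * s) ^+ 2)) ^+ 3.
Proof.
move: s6; generalize (1 + 6 * s) => t t0; rewrite h8 h9 hs.
by field; rewrite ?nz t0.
Qed.

Lemma lev6_root2 : s * (1 + 8 * s) * (1 + 9 * s) / D ^+ 2 =
  q * (v ^+ 7 * x ^+ 5 / (u ^+ 11 * y * D)) ^+ 2.
Proof.
move: D0; generalize D => t t0; rewrite h8 h9 hs.
by field; rewrite ?nz t0.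
Qed.

(** K is the weight 2 eta quotient eta_1^12 eta_6^2 / (eta_2^6 eta_3^4), where the powers of q
    cancel. It is the common factor of Z6, Z3 and Z3(2 tau) and drops out of the final ratios. *)
Lemma lev6_Z6 K : K = u ^+ 12 * y ^+ 2 / (v ^+ 6 * x ^+ 4) ->
  u * v * x * y / (v ^+ 7 * x ^+ 5 / (u ^+ 11 * y * D)) = D * K.
Proof. by move=> ->; move: D0; generalize D => t t0; field; rewrite ?nz t0. Qed.

Lemma lev6_Z3 K : K = u ^+ 12 * y ^+ 2 / (v ^+ 6 * x ^+ 4) ->
  u ^+ 2 * x ^+ 2 / (v ^+ 6 * x ^+ 6 / (u ^+ 10 * y ^+ 2 * (1 + 12 * s) ^+ 2)) =
  (1 + 12 * s) ^+ 2 * K.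
Proof. by move=> ->; move: (1 + 12 * s) s12 => t t0; field; rewrite ?nz t0. Qed.

Lemma lev6_Z3_sqr K : K = u ^+ 12 * y ^+ 2 / (v ^+ 6 * x ^+ 4) ->
  v ^+ 2 * y ^+ 2 / (v ^+ 8 * x ^+ 4 / (u ^+ 12 * (1 + 6 * s) ^+ 2)) =
  (1 + 6 * s) ^+ 2 * K.
Proof. by move=> ->; move: (1 + 6 * s) s6 => t t0; field; rewrite ?nz t0. Qed.

End LevelSixAlgebra.

Section FinalAlgebra.
Variables (F : numFieldType) (s : F).
Let D := 1 + 16 * s + 72 * s ^+ 2.
Let X := s * (1 + 8 * s) * (1 + 9 * s) / D ^+ 2.
Let rho := (1 - 72 * s ^+ 2) / D.
Hypotheses (D0 : D != 0) (s12 : 1 + 12 * s != 0) (s6 : 1 + 6 * s != 0).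
Hypotheses (s0 : s != 0) (s8 : 1 + 8 * s != 0) (s9 : 1 + 9 * s != 0).

Lemma discriminant_param : 1 - 32 * X = rho ^+ 2.
Proof. by rewrite /X /rho; move: D0; rewrite /D => h; field; rewrite h. Qed.

Lemma plus_param : 5 / 2 - 8 * X + 3 / 2 * rho = (2 * ((1 + 6 * s) ^+ 2 / D)) ^+ 2.
Proof. by rewrite /X /rho; move: D0; rewrite /D => h; field; rewrite h. Qed.

Lemma minus_param : 5 / 2 - 8 * X - 3 / 2 * rho = ((1 + 12 * s) ^+ 2 / D) ^+ 2.
Proof. by rewrite /X /rho; move: D0; rewrite /D => h; field; rewrite h. Qed.

Lemma yplus_param :
  2 * X ^+ 2 / (1 - 19 * X + 16 * X ^+ 2 + (1 - 5 * X) * rho) =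
  s ^+ 2 * (1 + 8 * s) * (1 + 9 * s) ^+ 2 / (1 + 6 * s) ^+ 6.
Proof.
have -> : 1 - 19 * X + 16 * X ^+ 2 + (1 - 5 * X) * rho =
    2 * (1 + 8 * s) * (1 + 6 * s) ^+ 6 / D ^+ 4.
  by rewrite /X /rho; move: D0; rewrite /D => h; field; rewrite h.
rewrite /X; move: D D0 (1 + 8 * s) s8 (1 + 6 * s) s6 => d d0 a a0 b b0.
by field; rewrite d0 a0 b0.
Qed.

(** Unlike for [yplus_param], the denominator contains the factor s (1 + 9 s), so s must be
    nonzero. *)
Lemma yminus_param :
  2 * X ^+ 2 / (1 - 19 * X + 16 * X ^+ 2 - (1 - 5 * X) * rho) =
  s * (1 + 8 * s) ^+ 2 * (1 + 9 * s) / (1 + 12 * s) ^+ 6.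
Proof.
have -> : 1 - 19 * X + 16 * X ^+ 2 - (1 - 5 * X) * rho =
    2 * s * (1 + 9 * s) * (1 + 12 * s) ^+ 6 / D ^+ 4.
  by rewrite /X /rho; move: D0; rewrite /D => h; field; rewrite h.
rewrite /X; move: D D0 (1 + 9 * s) s9 (1 + 12 * s) s12 => d d0 a a0 b b0.
by field; rewrite d0 a0 b0 s0.
Qed.

End FinalAlgebra.

(** * Values of X and Z for q near 0, with the branches of the roots *)

Section LevelSixNearZero.
Variable R : realType.
Implicit Types (q z tau : R[i]).

(** The radius 1/4 gives at once z != 0, Re z > 0 for square roots, and the hypothesis of
    [croot3_cube]. *)
Definition near1 z := cabs (z - 1) <= 1 / 4 :> R.

Lemma near1_neq0 z : near1 z -> z != 0.
Proof.
by rewrite /near1 -cabs_gt0; have := cabs_ge_sub 1 z; rewrite cabs1 cabsB; lra.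
Qed.

Lemma near1_Re z : near1 z -> 0 < complex.Re z.
Proof.
rewrite /near1 => h; have := normr_Re_le (z - 1).
have -> : complex.Re (z - 1) = complex.Re z - 1 by case: (z).
by rewrite ler_norml => /andP[]; lra.
Qed.

Lemma near1_near f : lip0 f -> f 0 = 1 -> \forall q \near (0 : R[i]), near1 (f q).
Proof.
move=> hf f0; have e0 : 0 < 1 / 4 :> R by lra.
by apply: filterS (lip0_near hf e0) => q; rewrite f0 => /ltW.
Qed.

Definition lev6_D q : R[i] := 1 + 16 * lev6_s q + 72 * lev6_s q ^+ 2.
Definition lev6_K q : R[i] := euler q ^+ 12 * euler (q ^+ 6) ^+ 2 /
  (euler (q ^+ 2) ^+ 6 * euler (q ^+ 3) ^+ 4).

(* X6 = q r2^2, X3 = q r3^3 and X3 (2 tau) = q^2 r3'^3. *)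
Definition lev6_r2 q : R[i] := euler (q ^+ 2) ^+ 7 * euler (q ^+ 3) ^+ 5 /
  (euler q ^+ 11 * euler (q ^+ 6) * lev6_D q).
Definition lev6_r3 q : R[i] := euler (q ^+ 2) ^+ 6 * euler (q ^+ 3) ^+ 6 /
  (euler q ^+ 10 * euler (q ^+ 6) ^+ 2 * (1 + 12 * lev6_s q) ^+ 2).
Definition lev6_r3' q : R[i] := euler (q ^+ 2) ^+ 8 * euler (q ^+ 3) ^+ 4 /
  (euler q ^+ 12 * (1 + 6 * lev6_s q) ^+ 2).

Lemma eulerX0 n : euler ((0 : R[i]) ^+ n.+1) = 1.
Proof. by rewrite expr0n euler0. Qed.

Lemma lip0_euler1 : lip0 (fun q => euler q).
Proof. exact: (lip0_euler R 0). Qed.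

Lemma lev6_s0 : lev6_s (0 : R[i]) = 0.
Proof. by rewrite /lev6_s !mul0r. Qed.

Lemma lev6_D0 : lev6_D 0 = 1.
Proof. by rewrite /lev6_D lev6_s0; ring. Qed.

Let lip_e n : lip0 (fun q => euler (q ^+ n.+1)) := lip0_euler R n.

Lemma lip0_lev6_s : lip0 (fun q => lev6_s q).
Proof.
apply: lip0_mul.
  apply: lip0_mul; last exact: lip0_exp (lip_e 5).
  by apply: lip0_mul (lip_e 1); exact: lip0_id.
apply: lip0_inv.
  by rewrite euler0 eulerX0 expr1n mulr1 oner_neq0.
by apply: lip0_mul (lip_e 2); apply: lip0_exp; exact: lip0_euler1.
Qed.

Lemma lip0_1as (a : R[i]) : lip0 (fun q => 1 + a * lev6_s q).
Proof.
apply: lip0_add; first exact: lip0_cst.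
by apply: lip0_mul lip0_lev6_s; exact: lip0_cst.
Qed.

Lemma lip0_lev6_D : lip0 lev6_D.
Proof.
apply: lip0_add (lip0_1as 16) _.
by apply: lip0_mul; [exact: lip0_cst|apply: lip0_exp; exact: lip0_lev6_s].
Qed.

Let as0 (a : R[i]) : 1 + a * lev6_s 0 = 1.
Proof. by rewrite lev6_s0 mulr0 addr0. Qed.

Let one := (euler0, eulerX0, lev6_D0, as0, expr1n, mulr1, invr1).

Lemma lip0_lev6_K : lip0 lev6_K.
Proof.
apply: lip0_mul; first by apply: lip0_mul; apply: lip0_exp; [exact: lip0_euler1|exact: (lip_e 5)].
apply: lip0_inv; first by rewrite !one oner_neq0.
by apply: lip0_mul; apply: lip0_exp; [exact: (lip_e 1)|exact: (lip_e 2)].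
Qed.

Lemma lev6_K0 : lev6_K 0 = 1.
Proof. by rewrite /lev6_K !one. Qed.

Lemma lip0_lev6_r2 : lip0 lev6_r2.
Proof.
apply: lip0_mul; first by apply: lip0_mul; apply: lip0_exp; [exact: (lip_e 1)|exact: (lip_e 2)].
apply: lip0_inv; first by rewrite !one oner_neq0.
apply: lip0_mul lip0_lev6_D; apply: lip0_mul (lip_e 5).
by apply: lip0_exp; exact: lip0_euler1.
Qed.

Lemma lev6_r20 : lev6_r2 0 = 1.
Proof. by rewrite /lev6_r2 !one. Qed.

Lemma lip0_lev6_r3 : lip0 lev6_r3.
Proof.
apply: lip0_mul; first by apply: lip0_mul; apply: lip0_exp; [exact: (lip_e 1)|exact: (lip_e 2)].
apply: lip0_inv; first by rewrite !one oner_neq0.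
apply: lip0_mul; last exact: lip0_exp (lip0_1as 12).
by apply: lip0_mul; apply: lip0_exp; [exact: lip0_euler1|exact: (lip_e 5)].
Qed.

Lemma lip0_lev6_r2V : lip0 (fun q => (lev6_r2 q ^+ 2)^-1).
Proof.
apply: lip0_inv (lip0_exp 2 lip0_lev6_r2).
by rewrite lev6_r20 expr1n oner_neq0.
Qed.

Lemma near1_r3' : \forall q \near (0 : R[i]), near1 (lev6_r3' q).
Proof.
apply: near1_near; last by rewrite /lev6_r3' !one.
apply: lip0_mul; first by apply: lip0_mul; apply: lip0_exp; [exact: (lip_e 1)|exact: (lip_e 2)].
apply: lip0_inv; first by rewrite !one oner_neq0.
apply: lip0_mul; last exact: lip0_exp (lip0_1as 6).
by apply: lip0_exp; exact: lip0_euler1.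
Qed.

(** The conditions on [lev6_r2], [lev6_r3], [lev6_r3'] select the roots in Z6, Z3 and Z3(2 tau). The
    last three select the square roots of g, a + b sqrt g (up to the factor 2) and a - b sqrt g. *)
Definition lev6_good q := [/\ cabs q <= 1 / 64, near1 (lev6_r2 q),
  near1 (lev6_r3 q), near1 (lev6_r3' q) &
  [/\ near1 (lev6_D q), near1 (1 + 6 * lev6_s q), near1 (1 + 12 * lev6_s q),
    near1 ((1 - 72 * lev6_s q ^+ 2) / lev6_D q) &
    near1 ((1 + 6 * lev6_s q) ^+ 2 / lev6_D q) /\
    near1 ((1 + 12 * lev6_s q) ^+ 2 / lev6_D q)]].

Lemma lev6_good_near : \forall q \near (0 : R[i]), lev6_good q.
Proof.
have lDV : lip0 (fun q => (lev6_D q)^-1).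
  by apply: lip0_inv lip0_lev6_D; rewrite lev6_D0 oner_neq0.
have h1 : \forall q \near (0 : R[i]), near1 ((1 - 72 * lev6_s q ^+ 2) / lev6_D q).
  apply: near1_near; last by rewrite lev6_D0 lev6_s0 expr0n mulr0 subr0 divr1.
  apply: lip0_mul lDV.
  rewrite (_ : (fun x => _) = (fun x => 1 + - 72 * lev6_s x ^+ 2)).
    apply: lip0_add; first exact: lip0_cst.
    by apply: lip0_mul; [exact: lip0_cst|exact: lip0_exp lip0_lev6_s].
  by apply/funext => x; rewrite mulNr.
have h2 (a : R[i]) :
    \forall q \near (0 : R[i]), near1 ((1 + a * lev6_s q) ^+ 2 / lev6_D q).
  apply: near1_near; last by rewrite !one.
  exact: lip0_mul (lip0_exp 2 (lip0_1as a)) lDV.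
have h3 : \forall q \near (0 : R[i]), cabs q <= 1 / 64.
  by apply/near0P; exists (1 / 64) => [|x /ltW //]; lra.
have h4 := near1_near lip0_lev6_r2 lev6_r20.
have h5 := near1_near lip0_lev6_D lev6_D0.
have h7 : \forall q \near (0 : R[i]), near1 (lev6_r3 q).
  by apply: near1_near lip0_lev6_r3 _; rewrite /lev6_r3 !one.
have h6 (a : R[i]) := near1_near (lip0_1as a) (as0 a).
near=> q; split; [near: q; exact: h3|near: q; exact: h4|near: q; exact: h7|
  near: q; exact: near1_r3'|].
split; [near: q; exact: h5|near: q; exact: h6|near: q; exact: h6|
  near: q; exact: h1|split; near: q; exact: h2].
Unshelve. all: by end_near.
Qed.

Lemma qpow1_double tau : qpow 1 (2 * tau) = qpow 1 tau ^+ 2.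
Proof. by rewrite qpow_double qpowX mulrC. Qed.

Lemma lev6_values tau (q := qpow 1 tau) (s := lev6_s q) : lev6_good q ->
  [/\ X6 tau = q * lev6_r2 q ^+ 2, X3 tau = q * lev6_r3 q ^+ 3,
      Z6 tau = lev6_D q * lev6_K q, Z3 tau = (1 + 12 * s) ^+ 2 * lev6_K q &
      [/\ Z3 (2 * tau) = (1 + 6 * s) ^+ 2 * lev6_K q,
        X6 tau = s * (1 + 8 * s) * (1 + 9 * s) / lev6_D q ^+ 2,
        X3 tau = s * (1 + 8 * s) ^+ 2 * (1 + 9 * s) / (1 + 12 * s) ^+ 6,
        X3 (2 * tau) = s ^+ 2 * (1 + 8 * s) * (1 + 9 * s) ^+ 2 / (1 + 6 * s) ^+ 6 &
        [/\ s != 0, 1 + 8 * s != 0 & 1 + 9 * s != 0]]].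
Proof.
case=> hq g2 g3 g3' [gD /near1_neq0 s6 /near1_neq0 s12 _ _].
have q0 : q != 0 := qpow_neq0 1 tau.
have hq4 : cabs q <= 1 / 4 by lra.
have eX n : euler (q ^+ n.+1) != 0 by apply: euler_neq0; exact: cabsX_small.
have u0 : euler q != 0 := eX 0; have v0 : euler (q ^+ 2) != 0 := eX 1.
have x0 : euler (q ^+ 3) != 0 := eX 2; have y0 : euler (q ^+ 6) != 0 := eX 5.
have [h8 h9] := lev6_identities hq; have D0 := near1_neq0 gD.
have x6 := X6E tau; have x3 := X3E tau; have x32 := X3E (2 * tau).
have z6 := Z6E tau; have z3 := Z3E tau; have z32 := Z3E (2 * tau).
cbv zeta in x6, x3, x32, z6, z3, z32.
rewrite -/q in x6 x3 z6 z3; rewrite qpow1_double -/q -!exprM in x32 z32.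
rewrite -[(2 * 3)%N]/6%N in x32 z32.
have X6s : X6 tau = s * (1 + 8 * s) * (1 + 9 * s) / lev6_D q ^+ 2.
  by rewrite x6 (lev6_X6 u0 v0 x0 y0 erefl erefl h8 h9 D0 erefl).
have X3s : X3 tau = s * (1 + 8 * s) ^+ 2 * (1 + 9 * s) / (1 + 12 * s) ^+ 6.
  by rewrite x3 (lev6_X3 u0 v0 x0 y0 erefl h8 h9 s12 erefl).
have X3s2 : X3 (2 * tau) = s ^+ 2 * (1 + 8 * s) * (1 + 9 * s) ^+ 2 / (1 + 6 * s) ^+ 6.
  by rewrite x32 (lev6_X3_sqr u0 v0 x0 y0 erefl h8 h9 s6 erefl).
have X6r : X6 tau = q * lev6_r2 q ^+ 2 by rewrite X6s (lev6_root2 u0 x0 y0 erefl h8 h9 D0).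
have X3r : X3 tau = q * lev6_r3 q ^+ 3 by rewrite X3s (lev6_root3 u0 x0 y0 erefl h8 h9 s12).
have X3r2 : X3 (2 * tau) = q ^+ 2 * lev6_r3' q ^+ 3.
  by rewrite X3s2 (lev6_root3_sqr u0 x0 y0 erefl h8 h9 s6).
have c2 : croot 2 (X6 tau / q) = lev6_r2 q.
  by rewrite X6r [q * _]mulrC mulfK // croot2_sqr // near1_Re.
have c3 : croot 3 (X3 tau / q) = lev6_r3 q.
  by rewrite X3r [q * _]mulrC mulfK // croot3_cube.
have c32 : croot 3 (X3 (2 * tau) / q ^+ 2) = lev6_r3' q.
  by rewrite X3r2 [_ * _ ^+ 3]mulrC mulfK ?expf_neq0 // croot3_cube.
split=> //.
- by rewrite z6 c2 (lev6_Z6 u0 v0 x0 y0 D0 erefl).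
- by rewrite z3 c3 (lev6_Z3 u0 v0 x0 y0 s12 erefl).
split=> //.
- by rewrite z32 c32 (lev6_Z3_sqr u0 v0 x0 s6 erefl).
split; first exact: (lev6_s_neq0 u0 v0 x0 y0 erefl q0).
- exact: (lev6_s8_neq0 u0 v0 x0 y0 h8).
- exact: (lev6_s9_neq0 u0 v0 x0 y0 h9).
Qed.

End LevelSixNearZero.

(** * Constant terms of the expansions, and local inversion of X6 *)

Section PowerSeries.
Variable R : realType.
Implicit Types (T : nat -> R[i]) (x y : R[i]).

Lemma series_bounded (u : nat -> R[i]) (l : R[i]) : series u @ \oo --> l ->
  exists2 C : R, 0 <= C & forall n, cabs (u n) <= C.
Proof.
move=> /cvgn_cabsP/(_ 1 ltr01)[N _ hN].
exists (2 + \sum_(0 <= k < N) cabs (u k)).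
  by rewrite addr_ge0 // sumr_ge0 // => k _; exact: cabs_ge0.
move=> n; have [nN|Nn] := ltnP n N.
  rewrite (big_cat_nat (leq0n n.+1) nN) /= big_nat_recr //=.
  have : 0 <= \sum_(0 <= k < n) cabs (u k) by apply: sumr_ge0 => k _; exact: cabs_ge0.
  have : 0 <= \sum_(n.+1 <= k < N) cabs (u k) by apply: sumr_ge0 => k _; exact: cabs_ge0.
  by lra.
have h1 := hN n Nn; have h2 := hN n.+1 (leqW Nn); rewrite /= in h1 h2.
have e : u n = (series u n.+1 - l) - (series u n - l).
  by rewrite seriesEnat /= big_nat_recr //=; ring.
have := cabsBD (series u n.+1 - l) (series u n - l); rewrite -e.
have : 0 <= \sum_(0 <= k < N) cabs (u k) by apply: sumr_ge0 => k _; exact: cabs_ge0.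
by lra.
Qed.

(** Continuity of a power series at 0 from convergence at one point y: the terms at y are bounded by
    some C, so those at x are at most C r^n with r = |x| / |y| <= 1/2, and all but the constant one
    sum to O(|x|). *)
Lemma pseries_dist T y (l : R[i]) : y != 0 ->
  series (fun n => T n * y ^+ n) @ \oo --> l ->
  exists2 C : R, 0 <= C & forall x (m : R[i]), cabs x <= cabs y / 2 ->
    series (fun n => T n * x ^+ n) @ \oo --> m -> cabs (m - T 0) <= C * cabs x.
Proof.
move=> y0 /series_bounded[C C0 hC]; have cy : 0 < cabs y by rewrite cabs_gt0.
exists (2 * C / cabs y); first by rewrite divr_ge0 ?mulr_ge0 ?cabs_ge0.
move=> x m hx hm; pose r := cabs x / cabs y.
have r0 : 0 <= r by rewrite divr_ge0 ?cabs_ge0.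
have r1 : r <= 1 / 2 by rewrite ler_pdivrMr //; lra.
have key n : cabs (series (fun n => T n * x ^+ n) n.+1 - T 0) <=
    2 * C * r * (1 - (1 / 2) ^+ n).
  elim: n => [|n ih].
    by rewrite seriesEnat /= big_nat1 expr0 mulr1 subrr cabs0 expr0 subrr mulr0.
  have -> : series (fun n => T n * x ^+ n) n.+2 - T 0 =
     (series (fun n => T n * x ^+ n) n.+1 - T 0) + T n.+1 * x ^+ n.+1.
    by rewrite seriesEnat /= big_nat_recr //=; ring.
  apply: le_trans (cabsD _ _) _.
  suff : cabs (T n.+1 * x ^+ n.+1) <= C * r * (1 / 2) ^+ n.
    by rewrite (exprS (1 / 2)); lra.
  have -> : cabs (T n.+1 * x ^+ n.+1) = cabs (T n.+1 * y ^+ n.+1) * r ^+ n.+1.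
    rewrite !cabsM !cabsX /r expr_div_n -mulrA; congr (_ * _).
    by rewrite mulrCA mulfV ?mulr1 // expf_neq0 // gt_eqF.
  rewrite -mulrA (exprS r); apply: ler_pM; [exact: cabs_ge0|by rewrite -exprS exprn_ge0|exact: hC|].
  by apply: ler_wpM2l => //; apply: lerXn2r => //; rewrite nnegrE.
have cv : (fun n => series (fun n => T n * x ^+ n) n.+1 - T 0) @ \oo --> m - T 0.
  by apply: cvgn_sub; [rewrite cvg_shiftS|exact: cvg_cst].
apply: (limn_cabs cv) => n; apply: le_trans (key n) _.
have -> : 2 * C / cabs y * cabs x = 2 * C * r by rewrite /r mulrAC !mulrA.
have := half_itv R n; have := mulr_ge0 (mulr_ge0 (ler0n R 2) C0) r0.
by nra.
Qed.

End PowerSeries.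

Section Expansions.
Variable R : realType.
Implicit Types (tau q x : R[i]).

Lemma qpow1_Im tau (B : R) : cabs (qpow 1 tau) < expR (- (2 * pi * B)) ->
  B < complex.Im tau.
Proof.
rewrite qpowE cabs_cexp /= ltr_expR mulr1 ltrN2 ltr_pM2l //.
by rewrite mulr_gt0 // pi_gt0.
Qed.

(** The hypotheses only give points where X is nonzero, so T 0 is reached as a limit: Z tends to 1
    as X tends to 0, and [pseries_dist], based at one fixed [t0], bounds |Z - T 0| by C |X|. *)
Lemma expansion0 (Z X : R[i] -> R[i]) (T : nat -> R[i]) : expansion Z X T ->
  (forall e : R, 0 < e -> exists2 d : R, 0 < d &
    forall tau, cabs (qpow 1 tau) < d ->
    [/\ X tau != 0, cabs (X tau) < e & cabs (Z tau - 1) < e]) -> T 0 = 1.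
Proof.
move=> [B hB] hX.
have small e : 0 < e -> exists tau, [/\ B < complex.Im tau, X tau != 0,
    cabs (X tau) < e & cabs (Z tau - 1) < e].
  move=> /hX[d d0 hd]; pose m := Num.min d (expR (- (2 * pi * B))) / 2.
  have m0 : 0 < m by rewrite divr_gt0 // lt_min d0 expR_gt0.
  have h : m%:C%C != 0 :> R[i] by rewrite -cabs_gt0 cabs_real // ltW.
  have [tau ht _] := qpow1_ex h; exists tau.
  have : cabs (qpow 1 tau) < Num.min d (expR (- (2 * pi * B))).
    by rewrite ht cabs_real ?ltW // /m; move: m0; rewrite /m; lra.
  rewrite lt_min => /andP[/hd[h1 h2 h3] /qpow1_Im h4].
  by split.
have [t0 [Bt0 Xt0 _ _]] := small 1 ltr01.
have [C C0 hC] := pseries_dist Xt0 (hB t0 Bt0).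
have h e : 0 < e -> cabs (T 0 - 1) <= (C + 1) * e.
  move=> e0; have [|t [Bt Xt Xe Ze]] := small (Num.min e (cabs (X t0) / 2)).
    by rewrite lt_min e0 divr_gt0 // cabs_gt0.
  move: Xe Ze; rewrite !lt_min => /andP[Xe Xh] /andP[Ze _].
  have := hC _ _ (ltW Xh) (hB t Bt); have := cabs_dist (T 0) (Z t) 1.
  by rewrite (cabsB (T 0) (Z t)); have := ler_wpM2l C0 (ltW Xe); lra.
apply/eqP; rewrite -subr_eq0 -cabs_eq0; apply/eqP/le_anti; rewrite cabs_ge0 andbT.
apply/ler_addgt0Pr => e e0; rewrite add0r.
have := h (e / (C + 1)); rewrite (mulrC (C + 1)) divfK ?gt_eqF ?ltr_wpDl //.
by apply; rewrite divr_gt0 ?ltr_wpDl.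
Qed.

Let one := (euler0, eulerX0, lev6_D0, lev6_K0, lev6_s0, expr1n, mulr1, invr1, mulr0, addr0).

Let near0_and (P Q : R[i] -> Prop) : (\forall x \near 0, P x) ->
  (\forall x \near 0, Q x) -> exists2 d : R, 0 < d & forall x, cabs x < d -> P x /\ Q x.
Proof. by move=> h k; apply/near0P; apply: filterI. Qed.

Lemma expansion6_0 (T : nat -> R[i]) : expansion (@Z6 R) (@X6 R) T -> T 0 = 1.
Proof.
move=> hT; apply: (expansion0 hT) => e e0.
have lip := lip0_mul (lip0_lev6_D R) (lip0_lev6_K R).
have lipX := lip0_mul (lip0_id R) (lip0_exp 2 (lip0_lev6_r2 R)).
have [d d0 hd] := near0_and (lev6_good_near R)
  (filterI (lip0_near lip e0) (lip0_near lipX e0)).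
exists d => // tau /hd[g [h1 h2]]; have [x6 _ z6 _ _] := lev6_values g.
have [_ /near1_neq0 r0 _ _ _] := g.
move: h1 h2; rewrite z6 x6 !one mul0r subr0 => h1 h2; split=> //.
by rewrite mulf_neq0 ?expf_neq0 ?qpow_neq0.
Qed.

Lemma expansion3_0 (T : nat -> R[i]) : expansion (@Z3 R) (@X3 R) T -> T 0 = 1.
Proof.
move=> hT; apply: (expansion0 hT) => e e0.
have lip := lip0_mul (lip0_exp 2 (lip0_1as (12 : R[i]))) (lip0_lev6_K R).
have lipX := lip0_mul (lip0_id R) (lip0_exp 3 (lip0_lev6_r3 R)).
have [d d0 hd] := near0_and (lev6_good_near R)
  (filterI (lip0_near lip e0) (lip0_near lipX e0)).
exists d => // tau /hd[g [h1 h2]]; have [_ x3 _ z3 _] := lev6_values g.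
have [_ _ /near1_neq0 r0 _ _] := g.
move: h1 h2; rewrite z3 x3 !one mul0r subr0 => h1 h2; split=> //.
by rewrite mulf_neq0 ?expf_neq0 ?qpow_neq0.
Qed.

(** Since X6 = q r2(q)^2, the equation X6 = x is the fixed point problem q = x / r2(q)^2. From x !=
    0 follows q != 0, so q = e^(2 pi i tau), and |q| <= M |x| puts tau above any prescribed
    height. *)
Lemma X6_surjective (B : R) : \forall x \near (0 : R[i]), x != 0 ->
  exists2 tau, B < complex.Im tau & lev6_good (qpow 1 tau) /\ X6 tau = x.
Proof.
have [M M0 /near0P[d1 d10 h1]] := lip0_fixpoint (lip0_lev6_r2V R).
have /near0P[d2 d20 h2] := lev6_good_near R.
pose m := Num.min d2 (expR (- (2 * pi * B))).
have m0 : 0 < m by rewrite lt_min d20 expR_gt0.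
apply/near0P; exists (Num.min d1 (m / (M + 1))).
  by rewrite lt_min d10 divr_gt0 ?ltr_wpDl.
move=> x; rewrite lt_min => /andP[/h1[q qM qE]]; rewrite ltr_pdivlMr ?ltr_wpDl // => xm x0.
have : cabs q < m by have := cabs_ge0 x; lra.
rewrite lt_min => /andP[/h2 g qB]; have [_ /near1_neq0 r0 _ _ _] := g.
have q0 : q != 0 by rewrite qE mulf_neq0 ?invr_eq0 ?expf_neq0.
have [tau ht _] := qpow1_ex q0; exists tau; first by apply: qpow1_Im; rewrite ht.
rewrite ht; split=> //; rewrite -ht in g; have [-> _ _ _ _] := lev6_values g.
by rewrite ht {1}qE divfK // expf_neq0.
Qed.

End Expansions.

(** * The algebraic functions y+ and y- near x = 0 *)

Section SquareRootBranch.
Variable R : realType.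
Implicit Types (x z : R[i]).

Lemma croot2_spec z : 0 < complex.Re z ->
  croot 2 z ^+ 2 = z /\ 0 < complex.Re (croot 2 z).
Proof.
move=> hz; have [r rz rp] : exists2 r : R[i], r ^+ 2 = z & 0 < complex.Re r.
  have hs := sqr_sqrtc z; move: (sqrtc z) hs => r hr.
  have [lt|gt|e] := ltgtP (complex.Re r) 0.
  - by exists (- r); rewrite ?sqrrN //; case: (r) lt => a b /=; rewrite oppr_gt0.
  - by exists r.
  - move: hz; rewrite -hr; case: (r) e => a b /= ->; rewrite expr2 /= mul0r sub0r.
    by rewrite oppr_gt0 ltNge -expr2 sqr_ge0.
by rewrite -rz croot2_sqr.
Qed.

Let g x : R[i] := 1 - 32 * x.
Let u x : R[i] := 1 - 19 * x + 16 * x ^+ 2 + (1 - 5 * x) * croot 2 (g x).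

Lemma sqrtg_spec x : cabs x <= 1 / 1000 ->
  croot 2 (g x) ^+ 2 = g x /\ cabs (croot 2 (g x) - 1) <= 32 * cabs x.
Proof.
move=> hx; have [|h1 h2] := @croot2_spec (g x).
  have := normr_Re_le (- (32 * x)); rewrite cabsN cabsM cabs_nat ler_norml.
  have -> : complex.Re (g x) = 1 + complex.Re (- (32 * x)) by rewrite /g; case: (32 * x).
  by move=> /andP[h _]; lra.
split=> //; move: h1 h2; set r := croot 2 _ => h1 h2.
have h3 : 1 <= cabs (r + 1).
  apply: le_trans (normr_Re_le _); apply: le_trans (ler_norm _).
  have -> : complex.Re (r + 1) = complex.Re r + 1 by case: (r).
  by lra.
have e : (r - 1) * (r + 1) = - (32 * x).
  have -> : (r - 1) * (r + 1) = r ^+ 2 - 1 by ring.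
  by rewrite h1 /g; ring.
have e2 : cabs (r - 1) * cabs (r + 1) = 32 * cabs x.
  by rewrite -cabsM e cabsN cabsM cabs_nat.
by have := ler_wpM2l (cabs_ge0 (r - 1)) h3; lra.
Qed.

Lemma sum_bound x : cabs x <= 1 / 1000 -> cabs (u x - 2) <= 70 * cabs x.
Proof.
move=> hx; have [_] := sqrtg_spec hx; rewrite /u; set r := croot 2 _ => hr.
have -> : 1 - 19 * x + 16 * x ^+ 2 + (1 - 5 * x) * r - 2 =
  (r - 1) + x * (16 * x - 24 - 5 * (r - 1)) by ring.
apply: le_trans (cabsD _ _) _; rewrite cabsM.
have h1 : cabs (16 * x - 24 - 5 * (r - 1)) <= 30.
  have := cabsBD (16 * x - 24) (5 * (r - 1)); have := cabsBD (16 * x) 24.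
  by rewrite !(cabsM _%:R) !cabs_nat; lra.
by have := ler_wpM2l (cabs_ge0 x) h1; have := cabs_ge0 x; lra.
Qed.

Lemma sum_neq0 x : cabs x <= 1 / 1000 -> 1 <= cabs (u x).
Proof.
by move=> hx; have := sum_bound hx; have := cabs_ge_sub 2 (u x);
  rewrite cabs_nat cabsB; lra.
Qed.

Lemma yplus_bound x : cabs x <= 1 / 1000 ->
  cabs (2 * x ^+ 2 / u x - x ^+ 2) <= 70 * cabs (x ^+ 3).
Proof.
move=> hx; have h1 := sum_neq0 hx; have h2 := sum_bound hx.
have u0 : u x != 0 by rewrite -cabs_gt0; lra.
have -> : 2 * x ^+ 2 / u x - x ^+ 2 = - (x ^+ 2 * (u x - 2) / u x).
  by move: (u x) u0 => v v0; field.
rewrite cabsN [cabs (_ / _)]cabsM [cabs (x ^+ 2 * _)]cabsM cabsV.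
rewrite ler_pdivrMr; last lra.
have h3 : cabs (x ^+ 2) * cabs (u x - 2) <= 70 * cabs (x ^+ 3).
  have -> : cabs (x ^+ 3) = cabs (x ^+ 2) * cabs x by rewrite -cabsM -exprSr.
  have := ler_wpM2l (cabs_ge0 (x ^+ 2)) h2; lra.
apply: le_trans h3 _; have h0 := cabs_ge0 (x ^+ 3).
by have := ler_wpM2l h0 h1; lra.
Qed.

(** The denominator v vanishes at 0. Multiplying by its conjugate u gives u v = c^2 - d^2 g = 4 x (1
    + 4 x)^3, so y- = x u / (2 (1 + 4 x)^3) for x != 0, with u close to 2. *)
Lemma yminus_bound x : cabs x <= 1 / 1000 ->
  cabs (2 * x ^+ 2 / (1 - 19 * x + 16 * x ^+ 2 - (1 - 5 * x) * croot 2 (g x)) - x)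
    <= 200 * cabs (x ^+ 2).
Proof.
move=> hx; have h1 := sum_neq0 hx; have h2 := sum_bound hx.
have u0 : u x != 0 by rewrite -cabs_gt0; lra.
have [gr _] := sqrtg_spec hx.
have b4 : cabs ((1 + 4 * x) ^+ 3 - 1) <= 30 * cabs x.
  have -> : (1 + 4 * x) ^+ 3 - 1 = x * (12 + x * (48 + 64 * x)) by ring.
  rewrite cabsM.
  have k1 : cabs (48 + 64 * x) <= 100.
    by have := cabsD 48 (64 * x); rewrite cabsM !cabs_nat; lra.
  have k2 : cabs (x * (48 + 64 * x)) <= 1 / 1000 * 100.
    by rewrite cabsM; apply: ler_pM => //; exact: cabs_ge0.
  have k3 : cabs (12 + x * (48 + 64 * x)) <= 30.
    by have := cabsD 12 (x * (48 + 64 * x)); rewrite cabs_nat; lra.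
  by have := ler_wpM2l (cabs_ge0 x) k3; lra.
have p3 : 1 / 2 <= cabs ((1 + 4 * x) ^+ 3).
  by have := cabs_ge_sub 1 ((1 + 4 * x) ^+ 3); rewrite cabs1 cabsB; lra.
set v := 1 - 19 * x + 16 * x ^+ 2 - (1 - 5 * x) * croot 2 (g x).
have uv : v * u x = 4 * x * (1 + 4 * x) ^+ 3.
  rewrite /v /u; move: gr; move: (croot 2 (g x)) => r gr.
  have -> : (1 - 19 * x + 16 * x ^+ 2 - (1 - 5 * x) * r) *
    (1 - 19 * x + 16 * x ^+ 2 + (1 - 5 * x) * r) =
    (1 - 19 * x + 16 * x ^+ 2) ^+ 2 - (1 - 5 * x) ^+ 2 * r ^+ 2 by ring.
  by rewrite gr /g; ring.
have [->|x0] := eqVneq x 0.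
  by rewrite expr0n mulr0 mul0r subrr cabs0 mulr0.
have w0 : (1 + 4 * x) ^+ 3 != 0 by rewrite -cabs_gt0; lra.
have v0 : v != 0.
  apply/eqP => v0; move/eqP: uv; rewrite v0 mul0r eq_sym.
  by rewrite mulf_eq0 (negbTE w0) orbF mulf_eq0 (negbTE x0) pnatr_eq0.
have -> : 2 * x ^+ 2 / v - x =
  x * ((u x - 2) - 2 * ((1 + 4 * x) ^+ 3 - 1)) / (2 * (1 + 4 * x) ^+ 3).
  move: uv w0; move: ((1 + 4 * x) ^+ 3) => w uv w0.
  have -> : 2 * x ^+ 2 / v = 2 * x ^+ 2 * u x / (v * u x).
    by rewrite ![_ * u x]mulrC cancel_div.
  by rewrite uv; move: (u x) => u'; field; rewrite x0 w0.
rewrite cabsM cabsV [cabs (x * _)]cabsM [cabs (2 * _)]cabsM cabs_nat.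
rewrite ler_pdivrMr; last lra.
have k : cabs (u x - 2 - 2 * ((1 + 4 * x) ^+ 3 - 1)) <= 130 * cabs x.
  by have := cabsBD (u x - 2) (2 * ((1 + 4 * x) ^+ 3 - 1)); rewrite cabsM cabs_nat; lra.
have k2 := ler_wpM2l (cabs_ge0 x) k.
have k3 := ler_wpM2l (cabs_ge0 (x ^+ 2)) p3.
have e : cabs (x ^+ 2) = cabs x * cabs x by rewrite expr2 cabsM.
by rewrite e in k3 *; have := mulr_ge0 (cabs_ge0 x) (cabs_ge0 x); lra.
Qed.

Lemma bigO_cabs (f h : R[i] -> R[i]) (k : R) : 0 < k ->
  (\forall x \near (0 : R[i]), cabs (f x) <= k * cabs (h x)) ->
  f =O_ (nbhs (0 : R[i])) h.
Proof.
move=> k0 hf; apply/eqO_exP; exists k%:C%C; first by rewrite ltcR.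
by apply: filterS hf => x hx; rewrite !cabsE -rmorphM lecR.
Qed.

Lemma cabs_le_near (e : R) : 0 < e -> \forall x \near (0 : R[i]), cabs x <= e.
Proof. by move=> e0; apply/near0P; exists e => // x /ltW. Qed.

End SquareRootBranch.

Theorem theorem8p1 (R : realType) (T3 T6 : nat -> R[i])
    (hT3 : expansion (@Z3 R) (@X3 R) T3) (hT6 : expansion (@Z6 R) (@X6 R) T6) :
  let c := fun x : R[i] => 1 - 19 * x + 16 * x ^+ 2 in
  let d := fun x : R[i] => 1 - 5 * x in
  let g := fun x : R[i] => 1 - 32 * x in
  let a := fun x : R[i] => 5 / 2 - 8 * x in
  let b : R[i] := 3 / 2 in
  let sqrtg := fun x : R[i] => croot 2 (g x) in
  let yp := fun x : R[i] => 2 * x ^+ 2 / (c x + d x * sqrtg x) in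
  let ym := fun x : R[i] => 2 * x ^+ 2 / (c x - d x * sqrtg x) in
  [/\ \forall x \near (0 : R[i]), x != 0 ->
        croot 3 ((c x ^+ 2 - d x ^+ 2 * g x) / (4 * x)) = 1 + 4 * x,
      \forall x \near (0 : R[i]),
        croot 2 ((a x ^+ 2 - b ^+ 2 * g x) / 4) = 1 + 4 * x,
      (fun x : R[i] => yp x - x ^+ 2) =O_ (nbhs (0 : R[i])) (fun x : R[i] => x ^+ 3),
      (fun x : R[i] => ym x - x) =O_ (nbhs (0 : R[i])) (fun x : R[i] => x ^+ 2) &
      \forall x \near (0 : R[i]),
        [/\ cvgn (series (Fterm T6 x)), cvgn (series (Fterm T3 (yp x))),
            cvgn (series (Fterm T3 (ym x))),
            Fsum T6 x = 2 / croot 2 (a x + b * sqrtg x) * Fsum T3 (yp x) &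
            Fsum T6 x = 1 / croot 2 (a x - b * sqrtg x) * Fsum T3 (ym x)]].
Proof.
have e0 : 0 < 1 / 1000 :> R by lra.
have near4 x : cabs x <= 1 / 1000 -> near1 (1 + 4 * x) :> Prop.
  by move=> hx; rewrite /near1 addrC addKr cabsM cabs_nat; lra.
move=> c d g a b sqrtg yp ym; split.
- apply: filterS (cabs_le_near e0) => x /near4 hx x0.
  have -> : (c x ^+ 2 - d x ^+ 2 * g x) / (4 * x) = (1 + 4 * x) ^+ 3.
    by rewrite /c /d /g; field.
  exact: croot3_cube.
- apply: filterS (cabs_le_near e0) => x /near4 hx.
  have -> : (a x ^+ 2 - b ^+ 2 * g x) / 4 = (1 + 4 * x) ^+ 2.
    by rewrite /a /b /g; field.
  by rewrite croot2_sqr // near1_Re.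
- apply: (@bigO_cabs _ _ _ 70) => //.
  by apply: filterS (cabs_le_near e0) => x /yplus_bound.
- apply: (@bigO_cabs _ _ _ 200) => //.
  by apply: filterS (cabs_le_near e0) => x /yminus_bound.
have [B3 h3] := hT3; have [B6 h6] := hT6.
have Fcvg (T : nat -> R[i]) (x l : R[i]) : series (fun n => T n * x ^+ n) @ \oo --> l ->
    cvgn (series (Fterm T x)) /\ Fsum T x = l.
  by move=> h; split; [exact: cvgP h|exact: cvg_lim h].
have F0 (T : nat -> R[i]) : series (fun n => T n * 0 ^+ n) @ \oo --> T 0.
  rewrite -cvg_shiftS; apply: (@cvgn_ext _ (fun=> T 0)); last exact: cvg_cst.
  move=> n; rewrite seriesEnat /= big_nat_recl //= expr0 mulr1 big1 ?addr0 //.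
  by move=> k _; rewrite exprS mul0r mulr0.
(* The absolute values force Im tau > 0, so that 2 tau lies above [B3] as well, even if [B3] is
   negative. *)
apply: filterS (X6_surjective (Num.max `|B3| `|B6|)) => x hx.
have [x0|/hx[tau]] := eqVneq x 0.
  have y0 : yp 0 = 0 by rewrite /yp expr0n mulr0 mul0r.
  have y0' : ym 0 = 0 by rewrite /ym expr0n mulr0 mul0r.
  have sg : sqrtg 0 = 1.
    rewrite /sqrtg /g mulr0 subr0 -[X in croot _ X](expr1n _ 2).
    by rewrite croot2_sqr //= ltr01.
  have [c6 f6] := Fcvg _ _ _ (F0 T6); have [c3 f3] := Fcvg _ _ _ (F0 T3).
  have ap : a 0 + b * 1 = 2 ^+ 2 by rewrite /a /b; field.
  have am : a 0 - b * 1 = 1 ^+ 2 by rewrite /a /b; field.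
  have r2 : 0 < complex.Re (2 : R[i]) by rewrite /= addr_gt0 ?ltr01.
  have r1 : 0 < complex.Re (1 : R[i]) by rewrite /= ltr01.
  rewrite x0 y0 y0' sg f6 f3 (expansion6_0 hT6) (expansion3_0 hT3) ap am.
  rewrite (croot2_sqr r2) (croot2_sqr r1).
  split; [exact: c6|exact: c3|exact: c3|by rewrite mulr1 mulfV ?pnatr_eq0|].
  by rewrite divr1 mulr1.
rewrite gt_max => /andP[B3t B6t] [good xE].
have [_ _ z6 z3 [z32 x6 x3 x32 [s0 s8 s9]]] := lev6_values good.
have [_ _ _ _ [/near1_neq0 D0 /near1_neq0 s6 /near1_neq0 s12 /near1_Re nr [np nm]]] := good.
have B3' : B3 < complex.Im tau := le_lt_trans (ler_norm _) B3t.
have B6' : B6 < complex.Im tau := le_lt_trans (ler_norm _) B6t.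
have B32 : B3 < complex.Im (2 * tau).
  have -> : complex.Im (2 * tau) = complex.Im tau + complex.Im tau.
    by rewrite mulr_natl mulr2n; case: (tau).
  by have := le_lt_trans (normr_ge0 _) B3t; lra.
have := h6 tau B6'; have := h3 tau B3'; have := h3 _ B32.
rewrite xE x3 x32 z6 z3 z32; rewrite xE in x6.
have sE : sqrtg x = (1 - 72 * lev6_s (qpow 1 tau) ^+ 2) / lev6_D (qpow 1 tau).
  by rewrite /sqrtg /g x6 (discriminant_param D0) croot2_sqr.
have cp : croot 2 (a x + b * sqrtg x) =
    2 * ((1 + 6 * lev6_s (qpow 1 tau)) ^+ 2 / lev6_D (qpow 1 tau)).
  rewrite sE /a /b x6 (plus_param D0) croot2_sqr // mulr_natl mulr2n.
  by move: (near1_Re np); case: (_ / _) => p p' /= hp; rewrite addr_gt0.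
have cm : croot 2 (a x - b * sqrtg x) =
    (1 + 12 * lev6_s (qpow 1 tau)) ^+ 2 / lev6_D (qpow 1 tau).
  by rewrite sE /a /b x6 (minus_param D0) croot2_sqr // near1_Re.
have ypE := yplus_param D0 s6 s8; have ymE := yminus_param D0 s12 s0 s9.
(* The expansions at 2 tau, tau and tau now are limits of the series of [T3] at y+ and y- and of
   [T6] at x. The three convergence claims come with them, and the equalities reduce to the ratios
   of (1 + 6 s)^2 K, (1 + 12 s)^2 K and D K. *)
rewrite -ypE -ymE -x6 -sE => /Fcvg[c32 f32] /Fcvg[c3 f3] /Fcvg[c6 f6].
split; [exact: c6|exact: c32|exact: c3| |].
- rewrite f6 f32 cp; move: D0 s6; generalize (lev6_D (qpow 1 tau)).
  generalize (1 + 6 * lev6_s (qpow 1 tau)) (lev6_K (qpow 1 tau)) => t k v v0 t0.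
  by field; rewrite t0 v0.
- rewrite f6 f3 cm; move: D0 s12; generalize (lev6_D (qpow 1 tau)).
  generalize (1 + 12 * lev6_s (qpow 1 tau)) (lev6_K (qpow 1 tau)) => t k v v0 t0.
  by field; rewrite t0 v0.
Qed.
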